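(* Let $Q=Q(d,d_0)$ be any compact Riemannian symmetric space of rank one (a sphere $S^d$, or one of $\mathbb R P^n,\mathbb C P^n,\mathbb H P^n$ ($n\ge2$), $\mathbb O P^2$), with normalized geodesic metric $\theta$ and normalized invariant measure $\mu$. Let $d\xi^{\natural}(r)=\sin r\,dr$ on $[0,\pi]$. Then for all $x_1,x_2\in Q$, $$\tau(x_1,x_2)=\gamma(Q)\,\theta^{\Delta}(\xi^{\natural},x_1,x_2),$$ where the constant $\gamma(Q)$ is given by $$\gamma(Q)=\frac{\langle\tau\rangle}{\langle\theta^{\Delta}(\xi^{\natural})\rangle}=\frac{\operatorname{diam}(Q,\tau)}{\operatorname{diam}(Q,\theta^{\Delta}(\xi^{\natural}))}.$$
   Context: $Q(d,d_0)$: for the sphere $S^d=\{x\in\mathbb R^{d+1}:\|x\|=1\}$ ($d\ge1$), $d_0=d$ and $\theta$ is the great-circle distance. For projective spaces $\mathbb F P^n$, $\mathbb F\in\{\mathbb R,\mathbb C,\mathbb H,\mathbb O\}$, $d_0=\dim_{\mathbb R}\mathbb F\in\{1,2,4,8\}$, $d=nd_0$, $n\ge2$ and $n=2$ if $\mathbb F=\mathbb O$; model: $\mathbb F P^n=\{\Pi\in\mathcal H(\mathbb F^{n+1}):\Pi^2=\Pi,\ \mathrm{Tr}\,\Pi=1\}$, where $\mathcal H(\mathbb F^{n+1})$ is the real space of Hermitian $(n+1)\times(n+1)$ matrices over $\mathbb F$ with inner product $\langle A,B\rangle=\mathrm{Re}\,\mathrm{Tr}\,AB$; the metric $\theta\in[0,\pi]$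 is the invariant Riemannian distance normalized to have diameter $\pi$, characterized by $\cos^2(\theta(\Pi_1,\Pi_2)/2)=\langle\Pi_1,\Pi_2\rangle$ (for $\mathbb F=\mathbb R,\mathbb C,\mathbb H$ this is $\cos\frac12\theta=|(\mathbf a,\mathbf b)|$ for unit vectors spanning the lines). In all cases $\mu$ is the invariant Riemannian measure normalized by $\mu(Q)=1$. Chordal metric: $\tau(x_1,x_2)=\sin\frac12\theta(x_1,x_2)$. Balls $B(y,r)=\{x:\theta(x,y)<r\}$. Symmetric difference metric: $\theta^{\Delta}(\xi,y_1,y_2)=\frac12\int_0^\pi\mu(B(y_1,r)\Delta B(y_2,r))\,d\xi(r)$. For a metric $\rho$, $\langle\rho\rangle=\int_{Q\times Q}\rho(y_1,y_2)\,d\mu(y_1)d\mu(y_2)$ and $\operatorname{diam}(Q,\rho)=\sup\rho(x_1,x_2)$. *)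

(* Defs.v *)
From HB Require Import structures.
From mathcomp Require Import all_boot all_order all_algebra.
From mathcomp Require Import all_classical all_reals all_analysis.
From mathcomp Require Import measurable_realfun.

Set Implicit Arguments.
Unset Strict Implicit.
Unset Printing Implicit Defensive.

Import Order.TTheory GRing.Theory Num.Theory.
Import numFieldNormedType.Exports.

Local Open Scope classical_set_scope.
Local Open Scope ring_scope.

Variant division_algebra : Set := Reals | Complexes | Quaternions | Octonions.

Definition cd_level (F : division_algebra) : nat :=
  match F with Reals => 0 | Complexes => 1 | Quaternions => 2 | Octonions => 3 end.

Section CayleyDickson.
Variable R : realType.

(* The Cayley-Dickson tower: levels 0, 1, 2, 3 are the real numbers, the
   complex numbers, the quaternions and the octonions, of real dimension 2 ^ k.
   Each level consists of pairs over the previous one, with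
     (a, b)^* = (a^*, - b)  and
     (a, b) * (c, d) = (a * c - d^* * b, d * a + b * c^* ).
   The product of the octonions is not associative, so that there is no ring
   structure in the sense of ssralg at level 3. *)
Fixpoint cd (k : nat) : zmodType :=
  if k is k'.+1 then (cd k' * cd k')%type : zmodType else R : zmodType.

Fixpoint cd_one (k : nat) : cd k :=
  match k return cd k with
  | 0 => (1 : R)
  | k'.+1 => (cd_one k', 0)
  end.

Fixpoint cd_re (k : nat) : cd k -> R :=
  match k return cd k -> R with
  | 0 => fun x => x
  | k'.+1 => fun x => cd_re x.1
  end.

Fixpoint cd_conj (k : nat) : cd k -> cd k :=
  match k return cd k -> cd k with
  | 0 => fun x => x
  | k'.+1 => fun x => (cd_conj x.1, - x.2)
  end.

Fixpoint cd_mul (k : nat) : cd k -> cd k -> cd k :=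
  match k return cd k -> cd k -> cd k with
  | 0 => fun x y => (x : R) * (y : R)
  | k'.+1 => fun x y =>
      (cd_mul x.1 y.1 - cd_mul (cd_conj y.2) x.2,
       cd_mul y.2 x.1 + cd_mul x.2 (cd_conj y.1))
  end.

Definition cd_mulmx (k m : nat) (A B : 'M[cd k]_m) : 'M[cd k]_m :=
  \matrix_(i, j) \sum_l cd_mul (A i l) (B l j).

Definition cd_trace (k m : nat) (A : 'M[cd k]_m) : cd k := \sum_i A i i.

Definition hermitian (k m : nat) (A : 'M[cd k]_m) : bool :=
  A == \matrix_(i, j) cd_conj (A j i).

Definition herm_inner (k m : nat) (A B : 'M[cd k]_m) : R :=
  cd_re (cd_trace (cd_mulmx A B)).

Lemma cd_conj0 k : cd_conj 0 = 0 :> cd k.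
Proof. by elim: k => //= k ->; rewrite oppr0. Qed.

Lemma cd_conj1 k : cd_conj (cd_one k) = cd_one k.
Proof. by elim: k => //= k ->; rewrite oppr0. Qed.

Lemma cd_mul0r k (x : cd k) : cd_mul 0 x = 0 /\ cd_mul x 0 = 0.
Proof.
elim: k x => [|k IH] /= x; first by rewrite mul0r mulr0.
by rewrite !cd_conj0 !(IH _).1 !(IH _).2 subr0 addr0.
Qed.

Lemma cd_mul11 k : cd_mul (cd_one k) (cd_one k) = cd_one k.
Proof.
elim: k => [|k IH] /=; first by rewrite mulr1.
by rewrite IH cd_conj0 !(cd_mul0r _).1 subr0 addr0.
Qed.

End CayleyDickson.

Section Models.
Variable R : realType.

Definition dot (m : nat) (x y : 'rV[R]_m) : R := \sum_i x 0 i * y 0 i.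

(* The library norm on 'rV[R]_m is the sup norm, hence the explicit one. *)
Definition sphere (d : nat) : Type :=
  {x : 'rV[R]_d.+1 | Num.sqrt (dot x x) == 1}.

Definition projective (F : division_algebra) (n : nat) : Type :=
  {P : 'M[cd R (cd_level F)]_n.+1 |
    [&& hermitian P, cd_mulmx P P == P & cd_trace P == cd_one R (cd_level F)]}.

Lemma sphere_point_subproof (d : nat) :
  Num.sqrt (dot (delta_mx 0 0 : 'rV[R]_d.+1) (delta_mx 0 0)) == 1.
Proof.
rewrite /dot (bigD1 ord0) //= big1 ?addr0 => [|i /negbTE i0].
  by rewrite !mxE !eqxx mulr1 sqrtr1.
by rewrite !mxE i0 andbF mulr0.
Qed.

Definition projective_point (F : division_algebra) (n : nat) :
    'M[cd R (cd_level F)]_n.+1 :=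
  \matrix_(i, j) (if (i == 0) && (j == 0) then cd_one R (cd_level F) else 0).

Lemma projective_point_subproof (F : division_algebra) (n : nat) :
  let P := projective_point F n in
  [&& hermitian P, cd_mulmx P P == P & cd_trace P == cd_one R (cd_level F)].
Proof.
apply/and3P; split.
- apply/eqP/matrixP => i j; rewrite !mxE andbC.
  by case: ifP => _; rewrite ?cd_conj1 ?cd_conj0.
- apply/eqP/matrixP => i j; rewrite mxE (bigD1 ord0) //= big1 ?addr0.
    rewrite !mxE eqxx andbT /=.
    by case: (i == 0); case: (j == 0) => /=;
      rewrite ?cd_mul11 ?(cd_mul0r _).1 ?(cd_mul0r _).2.
  by move=> l /negbTE l0; rewrite !mxE l0 andbF (cd_mul0r _).1.
- rewrite /cd_trace (bigD1 ord0) //= big1 ?addr0; first by rewrite mxE !eqxx.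
  by move=> l /negbTE l0; rewrite mxE l0.
Qed.

HB.instance Definition _ (d : nat) := Choice.on (sphere d).
HB.instance Definition _ (d : nat) :=
  isPointed.Build (sphere d)
    (exist (fun x : 'rV[R]_d.+1 => Num.sqrt (dot x x) == 1) _
      (sphere_point_subproof d)).

HB.instance Definition _ (F : division_algebra) (n : nat) :=
  Choice.on (projective F n).
HB.instance Definition _ (F : division_algebra) (n : nat) :=
  isPointed.Build (projective F n)
    (exist (fun P : 'M[cd R (cd_level F)]_n.+1 =>
        [&& hermitian P, cd_mulmx P P == P
          & cd_trace P == cd_one R (cd_level F)]) _
      (projective_point_subproof F n)).

End Models.

Variant rank_one_space : Set :=
| Sphere (d : nat) of (1 <= d)%N
| Projective (F : division_algebra) (n : nat)
    of (2 <= n)%N & (F = Octonions -> n = 2%N).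

Definition carrier (R : realType) (Q : rank_one_space) : pointedType :=
  match Q with
  | Sphere d _ => sphere R d
  | Projective F n _ _ => projective R F n
  end.

(* On a sphere this is the great-circle distance; on a projective space it is
   the element of [0, pi] with cos (theta / 2) ^+ 2 = herm_inner. *)
Definition theta (R : realType) (Q : rank_one_space) :
    carrier R Q -> carrier R Q -> R :=
  match Q return carrier R Q -> carrier R Q -> R with
  | Sphere d _ => fun x y => acos (dot (sval x) (sval y))
  | Projective F n _ _ => fun x y =>
      2 * acos (Num.sqrt (herm_inner (sval x) (sval y)))
  end.

Section Metrics.
Variables (R : realType) (Q : rank_one_space).
Implicit Types (x y : carrier R Q) (r : R).

Definition tau x y : R := sin (theta x y / 2).

Definition geo_ball y r : set (carrier R Q) := [set x | theta x y < r].

Definition geo_open (U : set (carrier R Q)) : Prop :=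
  forall x, U x -> exists2 r, 0 < r & geo_ball x r `<=` U.

(* The Borel sets of the topology of the metric theta. *)
Definition borel := g_sigma_algebraType geo_open.

(* The isometry group acts transitively on the compact space carrier R Q, so
   that exactly one Borel probability measure is invariant under it, namely the
   normalized Riemannian measure. *)
Definition isometry_invariant (mu : probability borel R) : Prop :=
  forall g : carrier R Q -> carrier R Q,
    bijective g -> (forall x y, theta (g x) (g y) = theta x y) ->
  forall A : set borel, measurable A -> mu (g @^-1` A) = mu A.

Definition theta_delta (mu : probability borel R)
    (xi : {measure set (measurableTypeR R) -> \bar R}) y1 y2 : R :=
  2^-1 * \int[xi]_(r in `[0, pi]) fine (mu (geo_ball y1 r `+` geo_ball y2 r)).

Definition mean (mu : probability borel R)
    (rho : carrier R Q -> carrier R Q -> R) : R :=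
  \int[(mu \x mu)%E]_z rho z.1 z.2.

Definition diam (rho : carrier R Q -> carrier R Q -> R) : R :=
  sup [set rho x y | x in setT & y in setT].

End Metrics.

Section XiNatural.
Variable R : realType.
Local Open Scope ereal_scope.

(* The measure sin r dr on [0, pi], extended by 0 to the real line. *)
Definition xi_natural (A : set (measurableTypeR R)) : \bar R :=
  \int[lebesgue_measure]_(r in A `&` `[0%R, pi]) (sin r)%:E.

Let xi_natural0 : xi_natural set0 = 0.
Proof. by rewrite /xi_natural set0I integral_set0. Qed.

Let xi_natural_ge0 A : 0 <= xi_natural A.
Proof.
apply: integral_ge0 => r [_]; rewrite /= in_itv /= => r0pi.
by rewrite lee_fin sin_ge0_pi.
Qed.

Let xi_natural_sigma_additive : semi_sigma_additive xi_natural.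
Proof.
move=> /= A mA tA mUA; rewrite /xi_natural setI_bigcupl.
rewrite ge0_integral_bigcup //=.
- by apply: is_cvg_ereal_nneg_natsum_cond => n _ _; exact: xi_natural_ge0.
- by move=> n; apply: measurableI => //; exact: measurable_itv.
- apply/measurable_EFinP; apply: measurable_funTS.
  by apply: continuous_measurable_fun; exact: continuous_sin.
- move=> r [n _ [_]]; rewrite /= in_itv /= => r0pi.
  by rewrite lee_fin sin_ge0_pi.
- exact: trivIset_setIr.
Qed.

HB.instance Definition _ := isMeasure.Build _ _ _ xi_natural
  xi_natural0 xi_natural_ge0 xi_natural_sigma_additive.

End XiNatural.

(* Main.v *)
(* Integrating [sin r] over the radii at which a point lies in exactly one of two
   balls gives, by Fubini,
     2 theta_delta(y1, y2) = int |cos theta(x, y1) - cos theta(x, y2)| dmu(x).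
   The function [cos theta] is affine in the scalar product of a Euclidean space
   containing the space: [<x, y>] on a sphere, [2 <x, y> - 1] on a projective
   space.  So the integrand is [|<x, y1 - y2>|] up to a constant, and it remains
   to see that isometries bring [y1 - y2] to [tau(y1, y2)] times a fixed element;
   the invariance of [mu] then gives theta_delta = c tau, where [c > 0] because
   finitely many differences [y1 - y2] span.
   On a sphere one uses Householder reflections.  On a projective space a Givens
   elimination moves [y1, y2] to a pair of real matrices supported on the first
   two coordinates, whose difference is diagonalized by a plane reflection, with
   eigenvalues [tau] and [- tau].  It uses reflections with real entries, which
   associate with everything, and phases making one off-diagonal entry real:
   diagonal conjugations for R, C, H, and for the octonions the triality maps
     u x,  z u,  (u y) u
   on the three off-diagonal entries, which respect products by a Moufang
   identity. *)
From HB Require Import structures.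
From mathcomp Require Import all_boot all_order all_algebra.
From mathcomp Require Import all_classical all_reals all_analysis.
From mathcomp Require Import measurable_realfun ring lra.
Require Import Defs.

Set Implicit Arguments.
Unset Strict Implicit.
Unset Printing Implicit Defensive.

Import Order.TTheory GRing.Theory Num.Theory.
Import numFieldNormedType.Exports.

Local Open Scope classical_set_scope.
Local Open Scope ring_scope.

(** * Cayley-Dickson algebras *)

Section CayleyDicksonTheory.
Variable R : realType.

(** Scalar product of the [2 ^ k] real coordinates, equal to the real part of [x y^*]. By
    [cd_dot_inj], identities in the algebra can be tested against it, so that moving factors across
    replaces reassociation. *)
Fixpoint cd_dot (k : nat) : cd R k -> cd R k -> R :=
  match k return cd R k -> cd R k -> R with
  | 0 => fun x y => (x : R) * (y : R)
  | k'.+1 => fun x y => cd_dot x.1 y.1 + cd_dot x.2 y.2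
  end.

Fixpoint cd_scale (k : nat) (a : R) : cd R k -> cd R k :=
  match k return cd R k -> cd R k with
  | 0 => fun x => a * (x : R)
  | k'.+1 => fun x => (cd_scale a x.1, cd_scale a x.2)
  end.

Lemma cd_addE k (x y : cd R k.+1) : x + y = (x.1 + y.1, x.2 + y.2).
Proof. by []. Qed.

Lemma cd_reD k (x y : cd R k) : cd_re (x + y) = cd_re x + cd_re y.
Proof. by elim: k x y => //= k IH x y; rewrite IH. Qed.

Lemma cd_conjN k (x : cd R k) : cd_conj (- x) = - cd_conj x.
Proof. by elim: k x => //= k IH x; rewrite IH. Qed.

Lemma cd_conjD k (x y : cd R k) : cd_conj (x + y) = cd_conj x + cd_conj y.
Proof. by elim: k x y => //= k IH x y; rewrite IH opprD. Qed.

Lemma cd_conjK k (x : cd R k) : cd_conj (cd_conj x) = x.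
Proof. by elim: k x => //= k IH [x y] /=; rewrite IH opprK. Qed.

Lemma cd_mulDlr k (x y z : cd R k) :
  cd_mul (x + y) z = cd_mul x z + cd_mul y z /\
  cd_mul z (x + y) = cd_mul z x + cd_mul z y.
Proof.
elim: k x y z => [|k IH] x y z /=; first by rewrite mulrDl mulrDr.
by rewrite !cd_conjD !(IH _ _ _).1 !(IH _ _ _).2 !opprD !cd_addE /=; split;
  congr pair; rewrite addrACA.
Qed.

Lemma cd_mulDl k (x y z : cd R k) : cd_mul (x + y) z = cd_mul x z + cd_mul y z.
Proof. by case: (cd_mulDlr x y z). Qed.

Lemma cd_mulDr k (x y z : cd R k) : cd_mul z (x + y) = cd_mul z x + cd_mul z y.
Proof. by case: (cd_mulDlr x y z). Qed.

Lemma cd_mulNl k (x z : cd R k) : cd_mul (- x) z = - cd_mul x z.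
Proof. by apply/eqP; rewrite -addr_eq0 -cd_mulDl addNr (cd_mul0r _).1. Qed.

Lemma cd_mulNr k (x z : cd R k) : cd_mul z (- x) = - cd_mul z x.
Proof. by apply/eqP; rewrite -addr_eq0 -cd_mulDr addNr (cd_mul0r _).2. Qed.

Lemma cd_conjM k (x y : cd R k) :
  cd_conj (cd_mul x y) = cd_mul (cd_conj y) (cd_conj x).
Proof.
elim: k x y => [|k IH] x y /=; first exact: mulrC.
rewrite cd_conjD !(cd_conjN, IH, cd_conjK, cd_mulNl, cd_mulNr, opprK).
by congr pair; rewrite opprD addrC.
Qed.

Lemma cd_dotC k (x y : cd R k) : cd_dot x y = cd_dot y x.
Proof. by elim: k x y => [|k IH] x y /=; rewrite 1?mulrC // !(IH _ y.1) (IH _ y.2). Qed.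

Lemma cd_dotDl k (x y z : cd R k) :
  cd_dot (x + y) z = cd_dot x z + cd_dot y z.
Proof. by elim: k x y z => [|k IH] x y z /=; rewrite ?mulrDl // !IH addrACA. Qed.

Lemma cd_dotDr k (x y z : cd R k) :
  cd_dot z (x + y) = cd_dot z x + cd_dot z y.
Proof. by rewrite !(cd_dotC z) cd_dotDl. Qed.

Lemma cd_dotNl k (x z : cd R k) : cd_dot (- x) z = - cd_dot x z.
Proof. by elim: k x z => [|k IH] x z /=; rewrite ?mulNr // !IH opprD. Qed.

Lemma cd_dotNr k (x z : cd R k) : cd_dot z (- x) = - cd_dot z x.
Proof. by rewrite !(cd_dotC z) cd_dotNl. Qed.

Lemma cd_dotZl k a (x z : cd R k) : cd_dot (cd_scale a x) z = a * cd_dot x z.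
Proof. by elim: k x z => [|k IH] x z /=; rewrite ?mulrA // !IH mulrDr. Qed.

Lemma cd_dotZr k a (x z : cd R k) : cd_dot z (cd_scale a x) = a * cd_dot z x.
Proof. by rewrite !(cd_dotC z) cd_dotZl. Qed.

Lemma cd_dot_ge0 k (x : cd R k) : 0 <= cd_dot x x.
Proof. by elim: k x => [|k IH] x /=; rewrite ?addr_ge0 // -expr2 sqr_ge0. Qed.

Lemma cd_dot_eq0 k (x : cd R k) : (cd_dot x x == 0) = (x == 0).
Proof.
elim: k x => [|k IH] x /=; first by rewrite mulf_eq0 orbb.
by rewrite paddr_eq0 ?cd_dot_ge0 // !IH; case: x.
Qed.

Lemma cd_dot_inj k (x y : cd R k) : (forall z, cd_dot x z = cd_dot y z) -> x = y.
Proof.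
move=> xy; apply/eqP; rewrite -subr_eq0 -cd_dot_eq0.
by rewrite cd_dotDl cd_dotNl xy subrr.
Qed.

Lemma cd_dot_conj k (x y : cd R k) : cd_dot (cd_conj x) (cd_conj y) = cd_dot x y.
Proof. by elim: k x y => [//|k IH] x y /=; rewrite IH cd_dotNl cd_dotNr opprK. Qed.

(** The transpose of a left or right multiplication is the multiplication by the conjugate. Both
    halves share one induction because the doubling formula swaps the order of factors. *)
Lemma cd_dotM k (x y z : cd R k) :
  cd_dot (cd_mul x y) z = cd_dot y (cd_mul (cd_conj x) z) /\
  cd_dot (cd_mul x y) z = cd_dot x (cd_mul z (cd_conj y)).
Proof.
elim: k x y z => [|k IH] x y z /=; first by split; ring.
have IHl u v w := (IH u v w).1; have IHr u v w := (IH u v w).2.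
have dotr (u v w : cd R k) :
    cd_dot (cd_mul (cd_conj u) v) w = cd_dot u (cd_mul v (cd_conj w)).
  by rewrite IHr -cd_dot_conj cd_conjK cd_conjM cd_conjK.
have dotl (u v w : cd R k) :
    cd_dot (cd_mul u (cd_conj v)) w = cd_dot v (cd_mul (cd_conj w) u).
  by rewrite IHl -cd_dot_conj cd_conjK cd_conjM cd_conjK.
rewrite !(cd_conjN, cd_conjK, cd_mulNl, cd_mulNr, opprK).
rewrite !(cd_dotDl, cd_dotDr, cd_dotNl, cd_dotNr); split.
  by rewrite (IHl x.1) (IHr y.2) dotr dotl; ring.
by rewrite (IHr x.1) (IHl y.2) (IHl _ _ z.1) cd_conjK (IHr x.2) cd_conjK; ring.
Qed.

Lemma cd_dotMl k (x y z : cd R k) :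
  cd_dot (cd_mul x y) z = cd_dot y (cd_mul (cd_conj x) z).
Proof. by case: (cd_dotM x y z). Qed.

Lemma cd_dotMr k (x y z : cd R k) :
  cd_dot (cd_mul x y) z = cd_dot x (cd_mul z (cd_conj y)).
Proof. by case: (cd_dotM x y z). Qed.

Lemma cd_mul1 k (x : cd R k) :
  cd_mul (cd_one R k) x = x /\ cd_mul x (cd_one R k) = x.
Proof.
elim: k x => [|k IH] x /=; first by rewrite mul1r mulr1.
rewrite cd_conj0 cd_conj1 !(cd_mul0r _).1 !(cd_mul0r _).2 !(IH _).1 !(IH _).2.
by rewrite subr0 addr0 add0r; case: x.
Qed.

Lemma cd_mul1l k (x : cd R k) : cd_mul (cd_one R k) x = x.
Proof. by case: (cd_mul1 x). Qed.

Lemma cd_mul1r k (x : cd R k) : cd_mul x (cd_one R k) = x.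
Proof. by case: (cd_mul1 x). Qed.

Lemma cd_dot1 k (x : cd R k) : cd_dot x (cd_one R k) = cd_re x.
Proof.
elim: k x => [|k IH] x /=; first by rewrite mulr1.
rewrite IH; suff -> : cd_dot x.2 0 = 0 by rewrite addr0.
by rewrite -(subrr 0) cd_dotDr cd_dotNr subrr.
Qed.

Lemma cd_re_mul_conj k (x y : cd R k) : cd_re (cd_mul x (cd_conj y)) = cd_dot x y.
Proof. by rewrite -cd_dot1 cd_dotMr cd_conjK cd_mul1l. Qed.

Lemma cd_re_conj k (x : cd R k) : cd_re (cd_conj x) = cd_re x.
Proof. by elim: k x => //= k IH x; rewrite IH. Qed.

Lemma cd_scaleDr k a (x y : cd R k) :
  cd_scale a (x + y) = cd_scale a x + cd_scale a y.
Proof.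
by apply: cd_dot_inj => z; rewrite !(cd_dotZl, cd_dotDl) mulrDr.
Qed.

Lemma cd_scaleA k a b (x : cd R k) :
  cd_scale a (cd_scale b x) = cd_scale (a * b) x.
Proof. by apply: cd_dot_inj => z; rewrite !cd_dotZl mulrA. Qed.

Lemma cd_scale1 k (x : cd R k) : cd_scale 1 x = x.
Proof. by apply: cd_dot_inj => z; rewrite !cd_dotZl mul1r. Qed.

Lemma cd_scale0 k (x : cd R k) : cd_scale 0 x = 0.
Proof.
apply: cd_dot_inj => z; rewrite !cd_dotZl mul0r.
by rewrite -(subrr 0) cd_dotDl cd_dotNl subrr.
Qed.

Lemma cd_scaler0 k a : cd_scale a (0 : cd R k) = 0.
Proof. by rewrite -{1}(cd_scale0 (0 : cd R k)) cd_scaleA mulr0 cd_scale0. Qed.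

Lemma cd_mulZl k a (x y : cd R k) :
  cd_mul (cd_scale a x) y = cd_scale a (cd_mul x y).
Proof. by apply: cd_dot_inj => z; rewrite !(cd_dotMr, cd_dotZl). Qed.

Lemma cd_mulZr k a (x y : cd R k) :
  cd_mul x (cd_scale a y) = cd_scale a (cd_mul x y).
Proof. by apply: cd_dot_inj => z; rewrite !(cd_dotMl, cd_dotZl). Qed.

Lemma cd_conjZ k a (x : cd R k) :
  cd_conj (cd_scale a x) = cd_scale a (cd_conj x).
Proof.
by apply: cd_dot_inj => z; rewrite -(cd_conjK z) cd_dot_conj !cd_dotZl cd_dot_conj.
Qed.

(** * Composition algebra identities *)

Lemma cd_mulA k (k2 : (k <= 2)%N) (x y z : cd R k) :
  cd_mul x (cd_mul y z) = cd_mul (cd_mul x y) z.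
Proof.
case: k k2 x y z => [|[|[|//]]] _ /=; first by move=> *; ring.
  by move=> [x1 x2] [y1 y2] [z1 z2] /=; congr pair; ring.
move=> [[x1 x2] [x3 x4]] [[y1 y2] [y3 y4]] [[z1 z2] [z3 z4]] /=.
by congr (pair (pair _ _) (pair _ _)) => /=; ring.
Qed.

(** After expansion the cross terms cancel by associativity one level below, whence the bound
    [3]. *)
Lemma cd_norm_mul k (k3 : (k <= 3)%N) (x y : cd R k) :
  cd_dot (cd_mul x y) (cd_mul x y) = cd_dot x x * cd_dot y y.
Proof.
elim: k k3 x y => [_ x y|k IH k3 x y] /=; first by ring.
rewrite !(cd_dotDl, cd_dotDr, cd_dotNl, cd_dotNr) !IH ?(ltnW k3) // !cd_dot_conj.
have cross : cd_dot (cd_mul (cd_conj y.2) x.2) (cd_mul x.1 y.1) =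
    cd_dot (cd_mul x.2 (cd_conj y.1)) (cd_mul y.2 x.1).
  by rewrite cd_dotMl cd_conjK (cd_dotMr x.2) cd_conjK cd_mulA.
rewrite (cd_dotC (cd_mul x.1 y.1)) (cd_dotC (cd_mul y.2 x.1) (cd_mul x.2 _)) cross.
by ring.
Qed.

Lemma cd_dot0l k (x : cd R k) : cd_dot 0 x = 0.
Proof. by rewrite -{1}(cd_scale0 (0 : cd R k)) cd_dotZl mul0r. Qed.

Lemma cd_conj_real k (x : cd R k) :
  cd_conj x = x -> x = cd_scale (cd_re x) (cd_one R k).
Proof.
elim: k x => [x _|k IH [x y] /= [xE yE]] /=; first by rewrite mulr1.
rewrite cd_scaler0 -IH //; congr pair; apply/eqP; rewrite -cd_dot_eq0.
have /eqP := congr1 (cd_dot y) yE; rewrite cd_dotNr => /eqP ?.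
by apply/eqP; lra.
Qed.

Lemma cd_mul_conj k (x : cd R k) :
  cd_mul x (cd_conj x) = cd_scale (cd_dot x x) (cd_one R k).
Proof.
by rewrite [LHS]cd_conj_real ?cd_re_mul_conj // cd_conjM cd_conjK.
Qed.

Lemma cd_dot_mull k (k3 : (k <= 3)%N) (x y z : cd R k) :
  cd_dot (cd_mul x y) (cd_mul x z) = cd_dot x x * cd_dot y z.
Proof.
have := cd_norm_mul k3 x (y + z).
rewrite cd_mulDr !(cd_dotDl, cd_dotDr) !cd_norm_mul //.
by rewrite (cd_dotC (cd_mul x z)) (cd_dotC z y) => ?; lra.
Qed.

Lemma cd_dot_mulr k (k3 : (k <= 3)%N) (x y z : cd R k) :
  cd_dot (cd_mul y x) (cd_mul z x) = cd_dot y z * cd_dot x x.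
Proof.
have := cd_norm_mul k3 (y + z) x.
rewrite cd_mulDl !(cd_dotDl, cd_dotDr) !cd_norm_mul //.
by rewrite (cd_dotC (cd_mul z x)) (cd_dotC z y) => ?; lra.
Qed.

(** Polarization of the norm identity in both factors: [cd_dot_mulr] linearized in its common right
    factor. *)
Lemma cd_dot_mul_exchange k (k3 : (k <= 3)%N) (x y z w : cd R k) :
  cd_dot (cd_mul x y) (cd_mul z w) =
  2 * cd_dot x z * cd_dot y w - cd_dot (cd_mul x w) (cd_mul z y).
Proof.
have := cd_dot_mulr k3 (y + w) x z.
rewrite !cd_mulDr !(cd_dotDl, cd_dotDr) !cd_dot_mulr //.
by rewrite (cd_dotC w y) => ?; lra.
Qed.

(** Left multiplication by [x] scales the scalar product by [|x|^2], and left multiplication by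
    [x^*] is its transpose. This replaces associativity in cancellations. *)
Lemma cd_conj_mulKl k (k3 : (k <= 3)%N) (x y : cd R k) :
  cd_mul (cd_conj x) (cd_mul x y) = cd_scale (cd_dot x x) y.
Proof.
by apply: cd_dot_inj => z; rewrite cd_dotMl cd_conjK cd_dot_mull // cd_dotZl.
Qed.

Lemma cd_conj_mulKr k (k3 : (k <= 3)%N) (x y : cd R k) :
  cd_mul (cd_mul y x) (cd_conj x) = cd_scale (cd_dot x x) y.
Proof.
apply: cd_dot_inj => z.
by rewrite cd_dotMr cd_conjK cd_dot_mulr // cd_dotZl mulrC.
Qed.

(* The pairing of [(u x) (z u)] with any element depends on [x] and [z] only
   through their product [x z]. *)
Lemma cd_moufang k (k3 : (k <= 3)%N) (u x z : cd R k) :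
  cd_mul (cd_mul u x) (cd_mul z u) = cd_mul (cd_mul u (cd_mul x z)) u.
Proof.
have pairing a b t : cd_dot (cd_mul (cd_mul u a) (cd_mul b u)) t =
    2 * cd_dot u t * cd_dot (cd_mul a b) (cd_conj u)
    - cd_dot u u * cd_dot t (cd_conj (cd_mul a b)).
  rewrite cd_dotMr cd_dot_mul_exchange // cd_conjM -cd_dotMr.
  have := cd_conj_mulKl k3 (cd_conj u) (cd_conj b).
  rewrite cd_conjK cd_dot_conj => ->; rewrite cd_dotZl.
  by rewrite (cd_dotC (cd_conj b)) (cd_dotMr t) cd_conjM.
apply: cd_dot_inj => t.
have := pairing (cd_mul x z) (cd_one R k) t.
by rewrite cd_mul1l cd_mul1r pairing => ->.
Qed.

Lemma cd_re_sum k (I : Type) (r : seq I) (P : pred I) (f : I -> cd R k) :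
  cd_re (\sum_(i <- r | P i) f i) = \sum_(i <- r | P i) cd_re (f i).
Proof.
apply: big_morph => [x y|]; first exact: cd_reD.
by rewrite -cd_dot1 cd_dot0l.
Qed.

Lemma cd_dot_sumr k (I : Type) (r : seq I) (P : pred I) (f : I -> cd R k) x :
  cd_dot x (\sum_(i <- r | P i) f i) = \sum_(i <- r | P i) cd_dot x (f i).
Proof.
apply: big_morph => [y z|]; first exact: cd_dotDr.
by rewrite cd_dotC cd_dot0l.
Qed.

Lemma cd_scale_sum k (I : Type) (r : seq I) (P : pred I) (f : I -> cd R k) a :
  cd_scale a (\sum_(i <- r | P i) f i) = \sum_(i <- r | P i) cd_scale a (f i).
Proof. by apply: big_morph; [exact: cd_scaleDr|exact: cd_scaler0]. Qed.

Lemma cd_re_one k : cd_re (cd_one R k) = 1.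
Proof. by elim: k. Qed.

Lemma cd_reZ k a (x : cd R k) : cd_re (cd_scale a x) = a * cd_re x.
Proof. by rewrite -!cd_dot1 cd_dotZl. Qed.

End CayleyDicksonTheory.

(** * Idempotent Hermitian matrices of trace one *)

Section Projections.
Variables (R : realType) (k m : nat).
Hypothesis k3 : (k <= 3)%N.
Implicit Types A B : 'M[cd R k]_m.

Definition adjoint A : 'M[cd R k]_m := \matrix_(i, j) cd_conj (A j i).

Definition is_projection A : bool :=
  [&& hermitian A, cd_mulmx A A == A & cd_trace A == cd_one R k].

Lemma hermitianP A : reflect (A = adjoint A) (hermitian A).
Proof. exact: eqP. Qed.

Lemma hermitianE A i j : hermitian A -> A i j = cd_conj (A j i).
Proof. by move=> /hermitianP {1}->; rewrite mxE. Qed.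

Lemma is_projectionP A :
  is_projection A ->
  [/\ hermitian A, cd_mulmx A A = A & cd_trace A = cd_one R k].
Proof. by case/and3P => ? /eqP ? /eqP. Qed.

Lemma is_projection_hermitian A : is_projection A -> hermitian A.
Proof. by case/and3P. Qed.

Lemma diag_real A i : hermitian A -> A i i = cd_scale (cd_re (A i i)) (cd_one R k).
Proof. by move=> hA; apply: cd_conj_real; rewrite -hermitianE. Qed.

(** The real part of [a b^*] is [cd_dot a b], so the trace form is Euclidean in the entries. *)
Lemma herm_innerE A B : hermitian B ->
  herm_inner A B = \sum_i \sum_l cd_dot (A i l) (B i l).
Proof.
move=> hB; rewrite /herm_inner /cd_trace cd_re_sum; apply: eq_bigr => i _.
rewrite mxE cd_re_sum; apply: eq_bigr => l _.
by rewrite (hermitianE l i hB) cd_re_mul_conj.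
Qed.

Lemma projection_entry A i j : is_projection A ->
  A i j = \sum_l cd_mul (A i l) (A l j).
Proof. by case/is_projectionP => _ AA _; rewrite -[in LHS]AA mxE. Qed.

Lemma projection_diag A i : is_projection A ->
  cd_re (A i i) = \sum_l cd_dot (A i l) (A i l).
Proof.
move=> pA; have hA := is_projection_hermitian pA.
rewrite (projection_entry _ _ pA) cd_re_sum; apply: eq_bigr => l _.
by rewrite (hermitianE l i hA) cd_re_mul_conj.
Qed.

Lemma projection_trace A : is_projection A -> \sum_i cd_re (A i i) = 1.
Proof.
case/is_projectionP => _ _ /(congr1 (@cd_re _ _)).
by rewrite /cd_trace cd_re_sum cd_re_one.
Qed.

Lemma projection_norm A : is_projection A ->
  \sum_i \sum_l cd_dot (A i l) (A i l) = 1.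
Proof.
move=> pA; rewrite -(projection_trace pA); apply: eq_bigr => i _.
by rewrite projection_diag.
Qed.

Lemma projection_diag_ge0 A i : is_projection A -> 0 <= cd_re (A i i).
Proof.
by move=> pA; rewrite projection_diag // sumr_ge0 // => l _; exact: cd_dot_ge0.
Qed.

(** The diagonal entry is the squared norm of its row. *)
Lemma projection_row0 A i l : is_projection A -> cd_re (A i i) = 0 -> A i l = 0.
Proof.
move=> pA; rewrite projection_diag // => /eqP.
rewrite psumr_eq0 => [/allP/(_ l)|j _]; last exact: cd_dot_ge0.
by rewrite mem_index_enum cd_dot_eq0 => /(_ isT)/eqP.
Qed.

Lemma herm_dotC A i j : hermitian A -> cd_dot (A i j) (A i j) = cd_dot (A j i) (A j i).
Proof. by move=> hA; rewrite (hermitianE _ _ hA) cd_dot_conj. Qed.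

(* With [p] the [j]-th diagonal entry and [v] the [j]-th column of [A], the
   squared norm of [p A - v v^*] is [p ^ 2 - 2 p ^ 2 + p ^ 2]. *)
Lemma projection_rank1 A i j l : is_projection A ->
  cd_scale (cd_re (A j j)) (A i l) = cd_mul (A i j) (A j l).
Proof.
move=> pA; have hA := is_projection_hermitian pA.
set p := cd_re (A j j).
pose Q i l := cd_scale p (A i l) - cd_mul (A i j) (A j l).
suff Q0 : \sum_i \sum_l cd_dot (Q i l) (Q i l) = 0.
  move/eqP: Q0; rewrite psumr_eq0 => [/allP/(_ i)|? _]; last first.
    by apply: sumr_ge0 => ? _; exact: cd_dot_ge0.
  rewrite mem_index_enum => /(_ isT) /=.
  rewrite psumr_eq0 => [/allP/(_ l)|? _]; last exact: cd_dot_ge0.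
  by rewrite mem_index_enum cd_dot_eq0 subr_eq0 => /(_ isT)/eqP.
have colE : \sum_i cd_dot (A i j) (A i j) = p.
  by rewrite /p projection_diag //; apply: eq_bigr => a _; rewrite herm_dotC.
(* Adjointness moves [A j l] to the other side, where the sum over [l] reassembles the entry
   [(i, j)] of [A A = A]; no triple product is reassociated. *)
have cross : \sum_i \sum_l cd_dot (A i l) (cd_mul (A i j) (A j l)) = p.
  rewrite -[RHS]colE; apply: eq_bigr => a _.
  rewrite [X in _ = cd_dot _ X](projection_entry a j pA).
  rewrite cd_dot_sumr; apply: eq_bigr => b _.
  by rewrite cd_dotC cd_dotMr -hermitianE.
have -> : \sum_i \sum_l cd_dot (Q i l) (Q i l) =
    p ^+ 2 * (\sum_i \sum_l cd_dot (A i l) (A i l))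
    - 2 * p * (\sum_i \sum_l cd_dot (A i l) (cd_mul (A i j) (A j l)))
    + (\sum_i cd_dot (A i j) (A i j)) * (\sum_l cd_dot (A j l) (A j l)).
  rewrite mulr_suml !mulr_sumr -sumrB -big_split /=; apply: eq_bigr => a _.
  rewrite !mulr_sumr -sumrB -big_split /=; apply: eq_bigr => b _.
  rewrite /Q !(cd_dotDl, cd_dotDr, cd_dotNl, cd_dotNr, cd_dotZl, cd_dotZr).
  rewrite cd_norm_mul // (cd_dotC (cd_mul _ _) (A a b)).
  by ring.
by rewrite projection_norm // cross colE -projection_diag // -/p; ring.
Qed.

(** The real part of the rank one relation at [l = i]: the [2 x 2] minor vanishes. *)
Lemma projection_minor A i j : is_projection A ->
  cd_dot (A i j) (A i j) = cd_re (A i i) * cd_re (A j j).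
Proof.
move=> pA; have hA := is_projection_hermitian pA.
have /(congr1 (@cd_re _ _)) := projection_rank1 i j i pA.
by rewrite (hermitianE j i hA) cd_re_mul_conj cd_reZ mulrC.
Qed.

(** Both matrices are unit vectors for the trace form. Hence the form is at most [1] on them, with
    equality only for equal matrices. *)
Lemma herm_inner_dist A B : is_projection A -> is_projection B ->
  \sum_i \sum_l cd_dot (A i l - B i l) (A i l - B i l) =
  2 * (1 - herm_inner A B).
Proof.
move=> pA pB; rewrite (herm_innerE _ (is_projection_hermitian pB)).
transitivity (\sum_i \sum_l cd_dot (A i l) (A i l)
    + \sum_i \sum_l cd_dot (B i l) (B i l)
    - 2 * (\sum_i \sum_l cd_dot (A i l) (B i l))).
  rewrite mulr_sumr -big_split /= -sumrB; apply: eq_bigr => i _.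
  rewrite mulr_sumr -big_split /= -sumrB; apply: eq_bigr => l _.
  rewrite !(cd_dotDl, cd_dotDr, cd_dotNl, cd_dotNr) (cd_dotC (B i l)).
  by ring.
by rewrite !projection_norm //; ring.
Qed.

Lemma herm_inner_le1 A B : is_projection A -> is_projection B ->
  herm_inner A B <= 1.
Proof.
move=> pA pB; have := herm_inner_dist pA pB.
suff : 0 <= \sum_i \sum_l cd_dot (A i l - B i l) (A i l - B i l) by move=> *; lra.
by do 2![apply: sumr_ge0 => ? _]; exact: cd_dot_ge0.
Qed.

Lemma herm_inner_eq1 A B : is_projection A -> is_projection B ->
  herm_inner A B = 1 -> A = B.
Proof.
move=> pA pB AB1; have := herm_inner_dist pA pB.
rewrite AB1 subrr mulr0 => /eqP.
rewrite psumr_eq0 => [/allP A0|? _]; last first.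
  by apply: sumr_ge0 => ? _; exact: cd_dot_ge0.
apply/matrixP => i l; have := A0 i; rewrite mem_index_enum => /(_ isT) /=.
rewrite psumr_eq0 => [/allP/(_ l)|? _]; last exact: cd_dot_ge0.
by rewrite mem_index_enum cd_dot_eq0 subr_eq0 => /(_ isT)/eqP.
Qed.

End Projections.

(** * Reflections and phases *)

Section Isometries.
Variables (R : realType) (k m : nat).
Hypothesis k3 : (k <= 3)%N.
Implicit Types A B : 'M[cd R k]_m.

Section Reflection.
Variables (i j : 'I_m) (c s : R).
Hypothesis ij : i != j.
Hypothesis cs1 : c ^+ 2 + s ^+ 2 = 1.

(** Left multiplication by the reflection with block [[c, s; s, - c]] at [i, j]. As an operation on
    rows with real coefficients it avoids bracketing products in a nonassociative algebra. *)
Definition reflect_rows A : 'M[cd R k]_m := \matrix_(a, b)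
  if a == i then cd_scale c (A i b) + cd_scale s (A j b)
  else if a == j then cd_scale s (A i b) + cd_scale (- c) (A j b)
  else A a b.

Definition reflect_cols A : 'M[cd R k]_m := \matrix_(a, b)
  if b == i then cd_scale c (A a i) + cd_scale s (A a j)
  else if b == j then cd_scale s (A a i) + cd_scale (- c) (A a j)
  else A a b.

Definition reflect_mx A := reflect_rows (reflect_cols A).

Let c2 : c ^+ 2 = 1 - s ^+ 2. Proof. by rewrite -cs1 addrK. Qed.

Let ji : (j == i) = false. Proof. by rewrite eq_sym; exact: negbTE. Qed.

Lemma reflect_mxC A : reflect_mx A = reflect_cols (reflect_rows A).
Proof.
apply/matrixP => a b; apply: cd_dot_inj => z; rewrite !mxE.
case: (a == i); case: (a == j); case: (b == i); case: (b == j);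
  rewrite /= ?(cd_dotDl, cd_dotZl) //; ring.
Qed.

Lemma reflect_rowsK : involutive reflect_rows.
Proof.
move=> A; apply/matrixP => a b; apply: cd_dot_inj => z; rewrite !mxE eqxx ji eqxx.
case: (a =P i) => [->|_]; last case: (a =P j) => [->|//];
  rewrite /= !(cd_dotDl, cd_dotZl); ring: c2.
Qed.

Lemma reflect_colsK : involutive reflect_cols.
Proof.
move=> A; apply/matrixP => a b; apply: cd_dot_inj => z; rewrite !mxE eqxx ji eqxx.
case: (b =P i) => [->|_]; last case: (b =P j) => [->|//];
  rewrite /= !(cd_dotDl, cd_dotZl); ring: c2.
Qed.

Lemma reflect_mxK : involutive reflect_mx.
Proof. by move=> A; rewrite reflect_mxC /reflect_mx reflect_rowsK reflect_colsK. Qed.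

Lemma adjoint_reflect_mx A : adjoint (reflect_mx A) = reflect_mx (adjoint A).
Proof.
rewrite [RHS]reflect_mxC; apply/matrixP => a b; rewrite !mxE.
by case: (a == i); case: (a == j); case: (b == i); case: (b == j);
  rewrite ?(cd_conjD, cd_conjZ).
Qed.

Lemma reflect_rowsM A B : cd_mulmx (reflect_rows A) B = reflect_rows (cd_mulmx A B).
Proof.
apply/matrixP => a b; rewrite !mxE !cd_scale_sum -!big_split /=.
by case: ifP => ai; last case: ifP => aj; apply: eq_bigr => l _;
  rewrite mxE ai ?aj ?cd_mulDl ?cd_mulZl.
Qed.

Lemma reflect_colsM A B : cd_mulmx A (reflect_cols B) = reflect_cols (cd_mulmx A B).
Proof.
apply/matrixP => a b; rewrite !mxE !cd_scale_sum -!big_split /=.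
by case: ifP => bi; last case: ifP => bj; apply: eq_bigr => l _;
  rewrite mxE ?bi ?bj ?cd_mulDr ?cd_mulZr.
Qed.

(** Only the summands [i] and [j] of each entry change, and the sum of these two is preserved since
    the reflection squares to the identity. *)
Lemma reflect_cancelM A B :
  cd_mulmx (reflect_cols A) (reflect_rows B) = cd_mulmx A B.
Proof.
apply/matrixP => a b; apply: cd_dot_inj => z; rewrite !mxE.
have ij' : j != i by rewrite ji.
rewrite (bigD1 i) // (bigD1 j) //= [in RHS](bigD1 i) // (bigD1 j) //= !addrA.
rewrite !(cd_dotDl _ (\sum_(_ < _ | _) _)); congr (_ + _); last first.
  congr (cd_dot _ _); apply: eq_bigr => l /andP[/negbTE li /negbTE lj].
  by rewrite !mxE li lj.
rewrite !mxE !eqxx ji.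
rewrite !(cd_mulDl, cd_mulDr, cd_mulZl, cd_mulZr, cd_dotDl, cd_dotZl).
ring: c2.
Qed.

Lemma reflect_mxM A B :
  cd_mulmx (reflect_mx A) (reflect_mx B) = reflect_mx (cd_mulmx A B).
Proof.
rewrite [reflect_mx B]reflect_mxC reflect_colsM /reflect_mx reflect_rowsM.
by rewrite reflect_cancelM -reflect_mxC.
Qed.

Lemma reflect_mx_trace A : cd_trace (reflect_mx A) = cd_trace A.
Proof.
apply: cd_dot_inj => z; rewrite /cd_trace.
have ij' : j != i by rewrite ji.
rewrite (bigD1 i) // (bigD1 j) //= [in RHS](bigD1 i) // (bigD1 j) //= !addrA.
rewrite !(cd_dotDl _ (\sum_(_ < _ | _) _)); congr (_ + _); last first.
  congr (cd_dot _ _); apply: eq_bigr => l /andP[/negbTE li /negbTE lj].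
  by rewrite !mxE li lj.
rewrite !mxE !eqxx ji /=.
rewrite !(cd_dotDl, cd_dotZl).
ring: c2.
Qed.

Lemma reflect_mx_projection A : is_projection A -> is_projection (reflect_mx A).
Proof.
case/is_projectionP => /hermitianP hA AA tA; apply/and3P; split.
- by apply/hermitianP; rewrite adjoint_reflect_mx -hA.
- by rewrite reflect_mxM AA.
- by rewrite reflect_mx_trace tA.
Qed.

Lemma reflect_mx_inner A B :
  herm_inner (reflect_mx A) (reflect_mx B) = herm_inner A B.
Proof. by rewrite /herm_inner reflect_mxM reflect_mx_trace. Qed.

Lemma reflect_mx_diagi A : hermitian A -> cd_re (reflect_mx A i i) =
  c ^+ 2 * cd_re (A i i) + 2 * (c * s) * cd_re (A i j) + s ^+ 2 * cd_re (A j j).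
Proof.
move=> hA; rewrite !mxE !eqxx !(cd_reD, cd_reZ).
by rewrite (hermitianE j i hA) cd_re_conj; ring.
Qed.

Lemma reflect_mx_diagj A : hermitian A -> cd_re (reflect_mx A j j) =
  s ^+ 2 * cd_re (A i i) - 2 * (c * s) * cd_re (A i j) + c ^+ 2 * cd_re (A j j).
Proof.
move=> hA; rewrite !mxE !eqxx ji !(cd_reD, cd_reZ).
by rewrite (hermitianE j i hA) cd_re_conj; ring.
Qed.

Lemma reflect_mx_diag A l : l != i -> l != j -> reflect_mx A l l = A l l.
Proof. by move=> /negbTE li /negbTE lj; rewrite !mxE li lj. Qed.

End Reflection.

(** Entrywise maps that play the role of conjugation by a diagonal unitary matrix. Compatibility
    with products is asked for three distinct indices only: otherwise a factor is a real diagonal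
    entry, or the product is a squared norm. *)
Record phase_family (f : 'I_m -> 'I_m -> cd R k -> cd R k) : Prop := PhaseFamily {
  phaseD : forall a b x y, f a b (x + y) = f a b x + f a b y;
  phaseZ : forall a b r x, f a b (cd_scale r x) = cd_scale r (f a b x);
  phase_conj : forall a b x, cd_conj (f a b x) = f b a (cd_conj x);
  phase_dot : forall a b x y, cd_dot (f a b x) (f a b y) = cd_dot x y;
  phase_diag : forall a x, f a a x = x;
  phaseM : forall a b e x y, a != b -> b != e -> a != e ->
    cd_mul (f a b x) (f b e y) = f a e (cd_mul x y) }.

Definition phase_mx (f : 'I_m -> 'I_m -> cd R k -> cd R k) A : 'M[cd R k]_m :=
  \matrix_(a, b) f a b (A a b).

Lemma phase_mx_hermitian f A :
  phase_family f -> hermitian A -> hermitian (phase_mx f A).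
Proof.
move=> pf hA; apply/hermitianP/matrixP => a b; rewrite !mxE phase_conj //.
by rewrite -hermitianE.
Qed.

Lemma phase_mx_projection f A :
  phase_family f -> is_projection A -> is_projection (phase_mx f A).
Proof.
move=> pf pA; have hA := is_projection_hermitian pA.
apply/and3P; split; first exact: phase_mx_hermitian.
  apply/eqP/matrixP => a b; rewrite !mxE (projection_entry a b pA).
  have fsum : f a b (\sum_l cd_mul (A a l) (A l b)) =
      \sum_l f a b (cd_mul (A a l) (A l b)).
    apply: big_morph => [x y|]; first exact: phaseD.
    by rewrite -(cd_scale0 0) phaseZ // cd_scale0 cd_scaler0.
  rewrite fsum; apply: eq_bigr => l _; rewrite !mxE.
  have [->|al] := eqVneq a l.
    rewrite phase_diag // (diag_real _ hA).
    by rewrite !cd_mulZl !cd_mul1l phaseZ.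
  have [->|bl] := eqVneq l b.
    rewrite phase_diag // (diag_real _ hA).
    by rewrite !cd_mulZr !cd_mul1r phaseZ.
  have [<-|ab] := eqVneq a b; last by rewrite phaseM.
  rewrite (hermitianE l a hA) -phase_conj // !cd_mul_conj phaseZ // phase_dot //.
  by rewrite phase_diag.
case/is_projectionP: pA => _ _ <-; apply/eqP; apply: eq_bigr => a _.
by rewrite mxE phase_diag.
Qed.

Lemma phase_mx_inner f A B : phase_family f -> hermitian B ->
  herm_inner (phase_mx f A) (phase_mx f B) = herm_inner A B.
Proof.
move=> pf hB; rewrite !herm_innerE //; last exact: phase_mx_hermitian.
by apply: eq_bigr => a _; apply: eq_bigr => b _; rewrite !mxE phase_dot.
Qed.

(** For [x != 0] take [u = x^* / |x|], so that [u x] is the real number [|x|]. *)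
Lemma phase_unit (x : cd R k) :
  exists2 u, cd_dot u u = 1 & cd_conj (cd_mul u x) = cd_mul u x.
Proof.
have [->|x0] := eqVneq x 0.
  exists (cd_one R k); first by rewrite cd_dot1 cd_re_one.
  by rewrite (cd_mul0r _).2 cd_conj0.
have N0 : 0 < cd_dot x x by rewrite lt_neqAle cd_dot_ge0 eq_sym cd_dot_eq0 x0.
exists (cd_scale (Num.sqrt (cd_dot x x))^-1 (cd_conj x)).
  rewrite cd_dotZl cd_dotZr cd_dot_conj mulrA -invfM -expr2 sqr_sqrtr ?ltW //.
  by rewrite mulVf // gt_eqF.
by rewrite cd_mulZl cd_conjZ cd_conjM cd_conjK.
Qed.

(** Conjugation by the diagonal matrix with [u] at place [i] and [1] elsewhere. The diagonal is left
    alone, being real for Hermitian matrices. *)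
Definition associative_phase (i : 'I_m) (u : cd R k) (a b : 'I_m) (x : cd R k) :=
  if a == b then x else
  if a == i then cd_mul u x else
  if b == i then cd_mul x (cd_conj u) else x.

Lemma associative_phaseP i u : (k <= 2)%N -> cd_dot u u = 1 ->
  phase_family (associative_phase i u).
Proof.
move=> k2 u1; rewrite /associative_phase; split=> a b.
- by move=> x y; do 3?[case: ifP => // _]; rewrite ?cd_mulDr ?cd_mulDl.
- by move=> r x; do 3?[case: ifP => // _]; rewrite ?cd_mulZr ?cd_mulZl.
- move=> x; rewrite [b == a]eq_sym; case ab: (a == b) => //.
  case ai: (a == i); case bi: (b == i) => //; rewrite ?cd_conjM ?cd_conjK //.
  by rewrite (eqP ai) (eqP bi) eqxx in ab.
- move=> x y; do 3?[case: ifP => // _].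
    by rewrite cd_dot_mull // u1 mul1r.
  by rewrite cd_dot_mulr // cd_dot_conj u1 mulr1.
- by rewrite eqxx.
move=> e x y ab be ae; rewrite (negbTE ab) (negbTE be) (negbTE ae).
case: ifP => [/eqP ai|_].
  have -> : (b == i) = false by rewrite -ai eq_sym; exact: negbTE.
  have -> : (e == i) = false by rewrite -ai eq_sym; exact: negbTE.
  by rewrite cd_mulA.
case: ifP => [/eqP bi|_].
  have -> : (e == i) = false by rewrite -bi eq_sym; exact: negbTE.
  rewrite cd_mulA // -(cd_mulA k2 x) -{2}(cd_conjK u) cd_mul_conj.
  by rewrite cd_dot_conj u1 cd_scale1 cd_mul1r.
by case: ifP => // _; rewrite cd_mulA.
Qed.

End Isometries.

(** * Triality phases for the octonions *)

Section OctonionPhase.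
Variables (R : realType) (k : nat).
Hypothesis k3 : (k <= 3)%N.
Implicit Types u x y : cd R k.

Lemma cd_scaleI a x y : a != 0 -> cd_scale a x = cd_scale a y -> x = y.
Proof.
move=> a0 /(congr1 (cd_scale a^-1)).
by rewrite !cd_scaleA mulVf // !cd_scale1.
Qed.

(** The Moufang identity for [x y] and [y^*] reads [(u (x y)) (y^* u) = |y|^2 (u x) u]. Multiplying
    on the right by [u^* y] and dividing by [|y|^2] gives the claim. *)
Lemma cd_moufang_l u x y : cd_dot u u = 1 ->
  cd_mul (cd_mul (cd_mul u x) u) (cd_mul (cd_conj u) y) = cd_mul u (cd_mul x y).
Proof.
move=> u1; have [->|y0] := eqVneq y 0; first by rewrite !(cd_mul0r _).2.
have := congr1 (fun w => cd_mul w (cd_conj (cd_mul (cd_conj y) u)))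
  (cd_moufang k3 u (cd_mul x y) (cd_conj y)).
rewrite /= !cd_conj_mulKr // cd_norm_mul // cd_dot_conj u1 mulr1.
rewrite cd_mulZr !cd_mulZl cd_conjM cd_conjK => /cd_scaleI -> //.
by rewrite cd_dot_eq0.
Qed.

Lemma cd_moufang_r u x y : cd_dot u u = 1 ->
  cd_mul (cd_mul x (cd_conj u)) (cd_mul (cd_mul u y) u) = cd_mul (cd_mul x y) u.
Proof.
move=> u1; have [->|x0] := eqVneq x 0; first by rewrite !(cd_mul0r _).1.
have := congr1 (fun w => cd_mul (cd_conj (cd_mul u (cd_conj x))) w)
  (cd_moufang k3 u (cd_conj x) (cd_mul x y)).
rewrite /= !cd_conj_mulKl // cd_norm_mul // cd_dot_conj u1 mul1r.
rewrite cd_mulZr !cd_mulZl cd_mulZr cd_conjM cd_conjK => /cd_scaleI -> //.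
by rewrite cd_dot_eq0.
Qed.

Lemma cd_flexible u x : cd_mul u (cd_mul x u) = cd_mul (cd_mul u x) u.
Proof. by have := cd_moufang k3 u (cd_one R k) x; rewrite cd_mul1l cd_mul1r. Qed.

(** With [l] the third index, the entries [(i, j)], [(j, l)], [(i, l)] go to [u x], [x u],
    [(u x) u]; conjugation forces the maps on the transposed entries. The product rule for [i, j, l]
    is then the Moufang identity. *)
Definition octonion_phase (i j : 'I_3) u (a b : 'I_3) x : cd R k :=
  if a == b then x else
  if a == i then
    if b == j then cd_mul u x else cd_mul (cd_mul u x) u
  else if b == i then
    if a == j then cd_mul x (cd_conj u)
    else cd_mul (cd_conj u) (cd_mul x (cd_conj u))
  else if a == j then cd_mul x u
  else if b == j then cd_mul (cd_conj u) x
  else x.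

Lemma octonion_phaseP i j u : i != j -> cd_dot u u = 1 ->
  phase_family (octonion_phase i j u).
Proof.
move=> ij u1; rewrite /octonion_phase; split=> a b.
- by move=> x y; do 5?[case: ifP => // _]; rewrite !(cd_mulDr, cd_mulDl).
- by move=> r x; do 5?[case: ifP => // _]; rewrite !(cd_mulZr, cd_mulZl).
- move=> x; rewrite [b == a]eq_sym; case ab: (a == b) => //.
  have excl (c d e f : 'I_3) : (c == d -> e == f -> false) ->
    (c == d) && (e == f) = false.
    by move=> H; apply/negbTE/negP => /andP[cd ef]; have := H cd ef.
  have aij : (a == i) && (a == j) = false.
    by apply: excl => /eqP-> /eqP ji; rewrite ji eqxx in ij.
  have bij : (b == i) && (b == j) = false.
    by apply: excl => /eqP-> /eqP ji; rewrite ji eqxx in ij.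
  have abi : (a == i) && (b == i) = false.
    by apply: excl => /eqP ai /eqP bi; rewrite ai bi eqxx in ab.
  have abj : (a == j) && (b == j) = false.
    by apply: excl => /eqP aj /eqP bj; rewrite aj bj eqxx in ab.
  move: aij bij abi abj.
  by case: (a == i); case: (b == i); case: (a == j); case: (b == j) => //=;
    rewrite ?cd_conjM ?cd_conjK.
- move=> x y; do 5?[case: ifP => // _]; rewrite ?cd_dot_mulr ?cd_dot_mull //;
    by rewrite ?cd_dot_mulr ?cd_dot_mull ?cd_dot_conj // u1 ?mul1r ?mulr1.
- by rewrite eqxx.
move=> e x y.
have ml := cd_moufang_l _ _ u1; have mr := cd_moufang_r _ _ u1.
have mlc v w : cd_mul (cd_mul v u) (cd_mul (cd_conj u) (cd_mul w (cd_conj u)))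
    = cd_mul (cd_mul v w) (cd_conj u).
  by apply: (can_inj (@cd_conjK R k)); rewrite !(cd_conjM, cd_conjK) ml.
have mrc v w : cd_mul (cd_mul (cd_conj u) (cd_mul v (cd_conj u))) (cd_mul u w)
    = cd_mul (cd_conj u) (cd_mul v w).
  by apply: (can_inj (@cd_conjK R k)); rewrite !(cd_conjM, cd_conjK) mr.
have mf v w : cd_mul (cd_mul (cd_conj u) v) (cd_mul w (cd_conj u)) =
    cd_mul (cd_conj u) (cd_mul (cd_mul v w) (cd_conj u)).
  by rewrite cd_flexible cd_moufang.
(* For each [i] and [j] there remain the six orders of three distinct indices: the Moufang identity,
   its forms [ml] and [mr], and the conjugates of all three cover them. *)
by move: a b e i j ij; do 5![case=> -[|[|[|//]]] ? //=]; move=> _ _ _ _;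
  rewrite ?cd_moufang.
Qed.

Lemma octonion_phaseK i j u : cd_dot u u = 1 -> forall a b,
  cancel (octonion_phase i j u a b) (octonion_phase i j (cd_conj u) a b).
Proof.
move=> u1 a b x; rewrite /octonion_phase cd_conjK.
have Kl y : cd_mul (cd_conj u) (cd_mul u y) = y.
  by rewrite cd_conj_mulKl // u1 cd_scale1.
have Kr y : cd_mul (cd_mul y u) (cd_conj u) = y.
  by rewrite cd_conj_mulKr // u1 cd_scale1.
have Kl' y : cd_mul u (cd_mul (cd_conj u) y) = y.
  by rewrite -{1}(cd_conjK u) cd_conj_mulKl // cd_dot_conj u1 cd_scale1.
have Kr' y : cd_mul (cd_mul y (cd_conj u)) u = y.
  by rewrite -{2}(cd_conjK u) cd_conj_mulKr // cd_dot_conj u1 cd_scale1.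
by case: (a == b); case: (a == i); case: (b == i); case: (a == j);
  case: (b == j); rewrite ?Kl ?Kr ?Kl' ?Kr' //
    -1?cd_flexible ?(Kr, Kl) // cd_flexible Kl' Kr'.
Qed.

End OctonionPhase.

Lemma associative_phaseK (R : realType) (k m : nat) (i : 'I_m) (u : cd R k) :
  (k <= 3)%N -> cd_dot u u = 1 -> forall a b,
  cancel (associative_phase i u a b) (associative_phase i (cd_conj u) a b).
Proof.
move=> k3 u1 a b x; rewrite /associative_phase; case: (a == b) => //.
case: (a == i); first by rewrite cd_conj_mulKl // u1 cd_scale1.
case: (b == i) => //; rewrite cd_conjK -{2}(cd_conjK u) cd_conj_mulKr // cd_dot_conj u1.
by rewrite cd_scale1.
Qed.

Section HalfAngle.
Variable R : realType.

(** For [c = cos t] and [s = sin t] these are [cos (t / 2)] and [sin (t / 2)], up to a common sign.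
    The formula divides by [cos (t / 2)], so [c = - 1] is treated apart. *)
Lemma half_angle (c s : R) : c ^+ 2 + s ^+ 2 = 1 ->
  exists c' s' : R, [/\ c' ^+ 2 + s' ^+ 2 = 1, c' ^+ 2 - s' ^+ 2 = c
                      & 2 * (c' * s') = s].
Proof.
move=> cs; have [c1|c1] := eqVneq c (- 1).
  have /eqP : s ^+ 2 = 0 by move: cs; rewrite c1 sqrrN expr1n; lra.
  rewrite sqrf_eq0 => /eqP ->.
  by exists 0, 1; split; rewrite ?c1; ring.
have c1' : 0 < 1 + c.
  by rewrite lt_neqAle eq_sym addrC addr_eq0 c1 /=; have := sqr_ge0 s; nra.
have r0 : 0 < Num.sqrt ((1 + c) / 2) by rewrite sqrtr_gt0 divr_gt0.
have r2 : Num.sqrt ((1 + c) / 2) ^+ 2 = (1 + c) / 2.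
  by rewrite sqr_sqrtr // divr_ge0 // ltW.
move: r0 r2; set r := Num.sqrt _ => r0 r2.
exists r, (s / (2 * r)).
have s2 : (s / (2 * r)) ^+ 2 = (1 - c) / 2.
  rewrite expr_div_n exprMn r2; have -> : s ^+ 2 = (1 - c) * (1 + c) by nra.
  by field; rewrite gt_eqF.
rewrite r2 s2; split; [by field|by field|].
by field; rewrite gt_eqF.
Qed.

End HalfAngle.

Lemma phase_mxK (R : realType) (k m : nat) (f f' : 'I_m -> 'I_m -> cd R k -> cd R k) :
  (forall a b, cancel (f a b) (f' a b)) -> cancel (phase_mx f) (phase_mx f').
Proof. by move=> fK A; apply/matrixP => a b; rewrite !mxE fK. Qed.

Lemma cd_level_le3 F : (cd_level F <= 3)%N.
Proof. by case: F. Qed.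

(** * Normal form of a pair of points *)

Section ProjectiveIsometries.
Variables (R : realType) (F : division_algebra) (n : nat).
Hypothesis octonion_plane : F = Octonions -> n = 2%N.
Notation X := (projective R F n).
Notation k := (cd_level F).
Notation M := 'M[cd R k]_n.+1.
Let k3 := cd_level_le3 F.
Implicit Types (x y : X) (i j l : 'I_n.+1).

Lemma projective_is_projection x : is_projection (sval x).
Proof. exact: (svalP x). Qed.

Lemma projective_inj x y : sval x = sval y -> x = y.
Proof.
case: x y => [A pA] [B pB] /= AB; rewrite AB in pA *.
by congr exist; exact: bool_irrelevance.
Qed.

Definition diag_entry x i : R := cd_re (sval x i i).

Definition projective_isometry (g : X -> X) :=
  bijective g /\ forall x y,
    herm_inner (sval (g x)) (sval (g y)) = herm_inner (sval x) (sval y).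

Lemma projective_isometry_comp g h : projective_isometry g ->
  projective_isometry h -> projective_isometry (g \o h).
Proof.
move=> [bg ig] [bh ih]; split; first exact: bij_comp.
by move=> x y /=; rewrite ig ih.
Qed.

Lemma projective_isometry_id : projective_isometry id.
Proof. by split => //; exists id. Qed.

Lemma isometry_lift (phi psi : M -> M) :
  (forall A, is_projection A -> is_projection (phi A)) ->
  (forall A, is_projection A -> is_projection (psi A)) ->
  cancel phi psi -> cancel psi phi ->
  (forall A B, is_projection A -> is_projection B ->
     herm_inner (phi A) (phi B) = herm_inner A B) ->
  exists2 g : X -> X, projective_isometry g & forall x, sval (g x) = phi (sval x).
Proof.
move=> pphi ppsi phiK psiK inner.
have pX := projective_is_projection.
pose g x : X := exist (fun A : M => is_projection A) _ (pphi _ (pX x)).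
pose h x : X := exist (fun A : M => is_projection A) _ (ppsi _ (pX x)).
exists g => //; split; last by move=> x y; exact: inner (pX x) (pX y).
by exists h => x; apply: projective_inj => /=; rewrite ?phiK ?psiK.
Qed.

Lemma reflect_isometry i j (c s : R) : i != j -> c ^+ 2 + s ^+ 2 = 1 ->
  exists2 g : X -> X, projective_isometry g &
    forall x, sval (g x) = reflect_mx i j c s (sval x).
Proof.
move=> ij cs; apply: (@isometry_lift _ (reflect_mx i j c s)).
- by move=> A; exact: reflect_mx_projection.
- by move=> A; exact: reflect_mx_projection.
- exact: reflect_mxK.
- exact: reflect_mxK.
- by move=> A B _ _; exact: reflect_mx_inner.
Qed.

Lemma phase_pair i j (u : cd R k) : i != j -> cd_dot u u = 1 ->
  exists f f' : 'I_n.+1 -> 'I_n.+1 -> cd R k -> cd R k,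
    [/\ phase_family f, phase_family f',
        forall a b, cancel (f a b) (f' a b), forall a b, cancel (f' a b) (f a b)
      & forall z, f i j z = cd_mul u z].
Proof.
move=> ij u1; have u1' : cd_dot (cd_conj u) (cd_conj u) = 1 by rewrite cd_dot_conj.
have [k2|] := leqP k 2.
  exists (associative_phase i u), (associative_phase i (cd_conj u)); split.
  - exact: associative_phaseP.
  - exact: associative_phaseP.
  - exact: associative_phaseK.
  - by move=> a b; rewrite -{2}(cd_conjK u); exact: associative_phaseK.
  - by move=> x; rewrite /associative_phase (negbTE ij) eqxx.
(* Level [3] means octonions, hence [n = 2], and a single index remains besides [i] and [j]. *)
move=> k2; have n2 : n = 2%N by apply: octonion_plane; case: (F) k2.
move: i j ij; rewrite n2 => i j ij.
exists (octonion_phase i j u), (octonion_phase i j (cd_conj u)); split.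
- exact: octonion_phaseP.
- exact: octonion_phaseP.
- exact: octonion_phaseK.
- by move=> a b; rewrite -{2}(cd_conjK u); exact: octonion_phaseK.
- by move=> x; rewrite /octonion_phase (negbTE ij) !eqxx.
Qed.

Lemma phase_isometry i j (u : cd R k) : i != j -> cd_dot u u = 1 ->
  exists2 g : X -> X, projective_isometry g &
    forall x, sval (g x) i j = cd_mul u (sval x i j) /\
      forall l, diag_entry (g x) l = diag_entry x l.
Proof.
move=> ij u1; have [f [f' [pf pf' fK f'K fE]]] := phase_pair ij u1.
have [||||A B _ pB|g ig gE] := @isometry_lift (phase_mx f) (phase_mx f').
- by move=> A; exact: phase_mx_projection.
- by move=> A; exact: phase_mx_projection.
- exact: phase_mxK.
- exact: phase_mxK.
- by rewrite phase_mx_inner // is_projection_hermitian.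
exists g => // x; split; first by rewrite gE mxE fE.
by move=> l; rewrite /diag_entry gE mxE phase_diag.
Qed.

Lemma realify_entry i j x : i != j ->
  exists2 g : X -> X, projective_isometry g &
    cd_conj (sval (g x) i j) = sval (g x) i j /\
    forall y l, diag_entry (g y) l = diag_entry y l.
Proof.
move=> ij; have [u u1 uE] := phase_unit (sval x i j).
have [g ig gE] := phase_isometry ij u1.
by exists g => //; split=> [|y]; [rewrite (gE x).1|case: (gE y)].
Qed.

Lemma diag_entry_ge0 x i : 0 <= diag_entry x i.
Proof. exact/projection_diag_ge0/projective_is_projection. Qed.

Lemma cd_dot_real (z : cd R k) : cd_conj z = z -> cd_dot z z = cd_re z ^+ 2.
Proof.
move=> zE; rewrite -cd_re_mul_conj {2}(cd_conj_real zE).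
by rewrite cd_conjZ cd_conj1 cd_mulZr cd_mul1r cd_reZ.
Qed.

(* A Givens step: make the [(i, j)] entry real, then rotate it away.  As the
   [2 x 2] block has rank one, its smaller eigenvalue is [0]. *)
Lemma eliminate i j x : i != j ->
  exists2 g : X -> X, projective_isometry g & diag_entry (g x) j = 0 /\
    forall y l, l != i -> l != j -> diag_entry (g y) l = diag_entry y l.
Proof.
move=> ij; have [h ih [hreal hdiag]] := realify_entry x ij.
set A := sval (h x) in hreal.
have pA : is_projection A := projective_is_projection (h x).
pose p := cd_re (A i i); pose q := cd_re (A j j); pose t := cd_re (A i j).
have p0 : 0 <= p by exact: projection_diag_ge0.
have q0 : 0 <= q by exact: projection_diag_ge0.
have tpq : t ^+ 2 = p * q by rewrite -projection_minor // cd_dot_real.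
have [c [s [cs1 csE]]] : exists c s : R, c ^+ 2 + s ^+ 2 = 1 /\
    s ^+ 2 * p - 2 * (c * s) * t + c ^+ 2 * q = 0.
  have [pq0|pq0] := eqVneq (p + q) 0.
    have [pE qE] : p = 0 /\ q = 0 by split; lra.
    have tE : t = 0 by apply/eqP; rewrite -sqrf_eq0 tpq pE mul0r.
    by exists 1, 0; rewrite pE qE tE; split; ring.
  (* The doubled angle of the eigenvector of the block for the eigenvalue [p + q]; it gives a unit
     vector because [t ^ 2 = p q]. *)
  have [|c [s [cs1 cE sE]]] := @half_angle R ((p - q) / (p + q)) (2 * t / (p + q)).
    rewrite !expr_div_n exprMn tpq; field; exact: pq0.
  exists c, s; split=> //.
  have s2 : s ^+ 2 = (1 - (p - q) / (p + q)) / 2 by lra.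
  have c2 : c ^+ 2 = (1 + (p - q) / (p + q)) / 2 by lra.
  rewrite s2 c2 sE.
  have -> : 2 * t / (p + q) * t = 2 * (p * q) / (p + q) by rewrite -tpq; field.
  by field.
have [r ir rE] := reflect_isometry ij cs1.
exists (r \o h); first exact: projective_isometry_comp.
split=> [|y l li lj] /=.
  by rewrite /diag_entry rE reflect_mx_diagj // is_projection_hermitian.
by rewrite /diag_entry rE reflect_mx_diag // -/(diag_entry _ _) hdiag.
Qed.

(** Each step alters the diagonal entries [i] and [j] only, so that zeros made earlier survive and
    the weight collects at [i]. *)
Lemma eliminate_seq i (s : seq 'I_n.+1) x : i \notin s -> uniq s ->
  exists2 g : X -> X, projective_isometry g &
    (forall j, j \in s -> diag_entry (g x) j = 0) /\
    forall y l, l != i -> l \notin s -> diag_entry (g y) l = diag_entry y l.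
Proof.
elim: s => [_ _|j s IH].
  by exists id; [exact: projective_isometry_id|split].
rewrite inE negb_or /= => /andP[ij is_] /andP[js us].
have [g ig [g0 gD]] := IH is_ us.
have [h ih [h0 hD]] := eliminate (g x) ij.
exists (h \o g); first exact: projective_isometry_comp.
split=> [l|y l li] /=.
  rewrite inE => /orP[/eqP->//|ls]; rewrite hD ?g0 //.
    by apply: contraNneq is_ => <-.
  by apply: contraNneq js => <-.
by rewrite inE negb_or => /andP[lj ls]; rewrite hD // gD.
Qed.

Lemma diag_entry_sum x : \sum_i diag_entry x i = 1.
Proof. exact/projection_trace/projective_is_projection. Qed.

(* [g x] is the [i]-th coordinate projection, and [g y] is real and supported on
   the coordinates [i] and [j]. *)
Lemma normal_form (i j : 'I_n.+1) x y : i != j ->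
  exists2 g : X -> X, projective_isometry g &
    [/\ diag_entry (g x) i = 1,
        forall l, l != i -> l != j -> diag_entry (g y) l = 0
      & cd_conj (sval (g y) i j) = sval (g y) i j].
Proof.
move=> ij.
have [|g ig [g0 _]] := @eliminate_seq i (rem i (enum 'I_n.+1)) x _
  (rem_uniq _ (enum_uniq _)).
  by rewrite mem_rem_uniq ?enum_uniq // inE eqxx.
have gx1 : diag_entry (g x) i = 1.
  rewrite -(diag_entry_sum (g x)) (bigD1 i) //= big1 ?addr0 // => l li.
  by apply: g0; rewrite mem_rem_uniq ?enum_uniq // inE li mem_enum.
(* The pivot is now [j], and [i] is left out, so that the first point keeps its diagonal entry [1]
   at [i]. *)
have [||h ih [h0 hD]] := @eliminate_seq j (rem j (rem i (enum 'I_n.+1))) (g y).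
- by rewrite mem_rem_uniq ?inE ?eqxx ?rem_uniq ?enum_uniq.
- by rewrite !rem_uniq ?enum_uniq.
have mem_ij l : (l \in rem j (rem i (enum 'I_n.+1))) = (l != j) && (l != i).
  by rewrite mem_rem_uniq ?inE ?rem_uniq ?enum_uniq // mem_rem_uniq ?enum_uniq //
    inE mem_enum andbT.
have [r ir [rreal rD]] := realify_entry (h (g y)) ij.
exists (r \o (h \o g)).
  by apply: projective_isometry_comp => //; exact: projective_isometry_comp.
split=> /=; [| |exact: rreal].
  by rewrite rD hD // mem_ij eqxx andbF.
by move=> l li lj; rewrite rD h0 // mem_ij lj.
Qed.

End ProjectiveIsometries.

(** * Symmetric difference metrics and chordal metrics *)

Section XiNaturalTheory.
Variable R : realType.
Local Open Scope ereal_scope.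

Lemma sin_integral (a b : R) : (a <= b)%R ->
  \int[lebesgue_measure]_(r in `]a, b]) (sin r)%:E = (cos a - cos b)%:E.
Proof.
rewrite le_eqVlt => /orP[/eqP ->|ab].
  by rewrite set_itvoc0 integral_set0 subrr.
rewrite integral_itv_obnd_cbnd; last first.
  apply/measurable_EFinP; apply: measurable_funTS.
  by apply: continuous_measurable_fun; exact: continuous_sin.
rewrite (@continuous_FTC2 _ sin (fun x => - cos x)%R) //.
- by rewrite -EFinB opprK addrC.
- by apply: continuous_subspaceT => x; exact: continuous_sin.
- split.
  + by move=> x _; exact: ex_derive.
  + by apply: cvg_at_right_filter; apply: cvgN; exact: continuous_cos.
  + by apply: cvg_at_left_filter; apply: cvgN; exact: continuous_cos.
- by move=> x _; rewrite derive1E derive_val opprK.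
Qed.

Lemma xi_natural_itv (a b : R) : (0 <= a)%R -> (a <= b)%R -> (b <= pi)%R ->
  xi_natural `]a, b] = (cos a - cos b)%:E.
Proof.
move=> a0 ab bpi; rewrite /xi_natural -sin_integral //; congr integral.
apply/setIidPl => r /=; rewrite !in_itv /= => /andP[ar rb].
by rewrite (le_trans a0 (ltW ar)) (le_trans rb bpi).
Qed.

Lemma xi_natural_fin_num : fin_num_fun (@xi_natural R).
Proof.
move=> A mA; rewrite ge0_fin_numE ?measure_ge0 //.
apply: (@le_lt_trans _ _ (xi_natural setT)).
  by apply: le_measure; rewrite ?inE //; exact: subsetT.
rewrite /xi_natural setTI -integral_itv_obnd_cbnd ?sin_integral ?pi_ge0 ?ltry //.
apply/measurable_EFinP; apply: measurable_funTS.
by apply: continuous_measurable_fun; exact: continuous_sin.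
Qed.

HB.instance Definition _ := Measure_isFinite.Build _ _ _ (@xi_natural R)
  xi_natural_fin_num.

(** For [a <= b] the condition on [r] describes []a, b]], over which [sin] integrates to
    [cos a - cos b]. *)
Lemma xi_natural_between (a b : R) : (0 <= a <= pi)%R -> (0 <= b <= pi)%R ->
  xi_natural [set r | (0 <= r <= pi)%R && ((a < r) (+) (b < r))%R] =
  `|cos a - cos b|%:E.
Proof.
wlog ab : a b / (a <= b)%R => [H a0pi b0pi|].
  have [ab|/ltW ba] := leP a b; first exact: H.
  rewrite distrC -H //; congr xi_natural; apply/seteqP.
  by split => r /=; rewrite addbC.
move=> /andP[a0 api] /andP[b0 bpi].
have cos_le : (cos b <= cos a)%R.
  rewrite leNgt ltr_cos ?in_itv /= ?a0 ?b0 // -leNgt //.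
rewrite ger0_norm ?subr_ge0 // -xi_natural_itv //; congr xi_natural.
apply/seteqP; split => r /=; rewrite in_itv /=.
  move=> /andP[_]; case: (ltP a r) => ar /=; first by rewrite -leNgt.
  by rewrite ltNge (le_trans ar ab).
move=> /andP[ar rb]; rewrite (le_trans a0 (ltW ar)) (le_trans rb bpi) ar /=.
by rewrite -leNgt.
Qed.

End XiNaturalTheory.

(** A zero integral would put the whole space, of mass [1], in a null set. *)
Lemma integral_gt0 d (T : measurableType d) (R : realType) (P : probability T R)
    (f : T -> R) : measurable_fun setT f -> (forall x, 0 < f x) ->
  (0 < \int[P]_x (f x)%:E)%E.
Proof.
move=> mf f0; rewrite lt_neqAle integral_ge0 ?andbT; last first.
  by move=> x _; rewrite lee_fin ltW.
apply/eqP => /esym int0.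
have /ae_eq_integral_abs : (\int[P]_x `|(f x)%:E| = 0)%E.
  by rewrite -[RHS]int0; apply: eq_integral => x _; rewrite gee0_abs // lee_fin ltW.
move=> /(_ measurableT); case.
  exact/measurable_EFinP.
move=> N [mN N0 sub]; have NT : N = setT.
  apply/seteqP; split => // x _; apply: sub => /= /(_ I) [] fx0.
  by have := f0 x; rewrite fx0 ltxx.
by have := @probability_setT _ _ _ P; rewrite -NT N0 => /eqP; rewrite lt_eqF ?lte01.
Qed.

Lemma integral_probability_cst d (T : measurableType d) (R : realType)
    (P : probability T R) (r : \bar R) : (\int[P]_x r = r)%E.
Proof.
rewrite (@integral_cst _ _ _ P setT measurableT r).
by rewrite [X in (_ * X)%E](_ : _ = 1%E) ?mule1 //; exact: probability_setT.
Qed.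

Lemma sup_attained (R : realType) (A : set R) (M : R) :
  A M -> (forall x, A x -> x <= M) -> sup A = M.
Proof.
move=> AM leM; apply/eqP; rewrite eq_le ge_sup ?ub_le_sup //; first by exists M.
by exists M.
Qed.

Lemma tau_cos (R : realType) (Q : rank_one_space) (x y : carrier R Q) :
  0 <= theta x y <= pi -> tau x y = Num.sqrt ((1 - cos (theta x y)) / 2).
Proof.
move=> /andP[th0 thpi].
rewrite /tau; set t := theta x y / 2; have -> : theta x y = t *+ 2.
  by rewrite /t -mulr_natr divfK.
rewrite mulr2n cosD -!expr2 cos2sin2.
have -> : (1 - (1 - sin t ^+ 2 - sin t ^+ 2)) / 2 = sin t ^+ 2 by field.
rewrite sqrtr_sqr ger0_norm // sin_ge0_pi // /t; have := pi_ge0 R; lra.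
Qed.

(** * Proportionality of the metrics from a list of geometric properties *)

Section RankOneAnalysis.
Variables (R : realType) (Q : rank_one_space).
Notation X := (carrier R Q).
Notation th := (@theta R Q).
Notation B := (borel R Q).

Definition isometry (g : X -> X) : Prop :=
  bijective g /\ forall x y, th (g x) (g y) = th x y.

(* [cos_embedding] serves only measurability: it makes the Borel sets of [theta]
   fine enough for [cos theta] to be measurable for the product of the Borel
   sigma-algebra with itself. *)
Record rank_one_geometry : Prop := RankOneGeometry {
  theta_itv : forall x y, 0 <= th x y <= pi;
  tau_eq0 : forall x y : X, tau x y = 0 -> x = y;
  cos_embedding : exists (I : finType) (e : I -> X -> R) (a b : R),
    (forall x y, cos (th x y) = a * (\sum_i e i x * e i y) + b) /\
    (forall i x y, (e i x - e i y) ^+ 2 <= 2 * (1 - cos (th x y)));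
  difference_orbit : exists a b : X, tau a b = 1 /\
    forall y1 y2, exists2 g, isometry g & forall x,
      `|cos (th x y1) - cos (th x y2)| =
      tau y1 y2 * `|cos (th (g x) a) - cos (th (g x) b)|;
  separating_pairs : exists s : seq (X * X), forall x,
    exists2 p, p \in s & cos (th x p.1) != cos (th x p.2);
  isometry_transitive : exists p0 : X, forall x, exists2 g, isometry g & g x = p0 }.

Hypothesis geometry : rank_one_geometry.

Lemma measurable_geo_open (U : set B) : geo_open U -> measurable U.
Proof. exact: sub_sigma_algebra. Qed.

Lemma isometry_measurable (g : X -> X) :
  isometry g -> measurable_fun setT (g : B -> B).
Proof.
move=> [_ gE]; apply: (@measurability _ _ B B _ _ (@geo_open R Q)) => //.
move=> _ [U oU <-]; rewrite setTI; apply: measurable_geo_open => x /oU[r r0 rU].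
by exists r => // y xy; apply: rU; rewrite /geo_ball /= gE.
Qed.

(** The bound is [|f x - f y| <= 2 tau x y]. By continuity of [cos] at [0], the sets where [f > a]
    are then open for [theta]. *)
Lemma lipschitz_measurable (f : X -> R) :
  (forall x y, (f x - f y) ^+ 2 <= 2 * (1 - cos (th x y))) ->
  measurable_fun setT (f : B -> R).
Proof.
move=> lip; apply: (measurability _ (RGenOInfty.measurableE R)) => _ [_ [a ->] <-].
rewrite setTI; apply: measurable_geo_open => x /=.
rewrite in_itv /= andbT -subr_gt0 => e0; set e := f x - a in e0.
have := @continuous_cos R 0 => /cvgrPdist_lt /(_ (e ^+ 2 / 2)).
rewrite divr_gt0 ?exprn_gt0 // => /(_ isT) /nbhs_ballP[r r0 rcos].
exists r => // y; rewrite /geo_ball /= => yx.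
have th0 : 0 <= th y x by have /andP[] := theta_itv geometry y x.
have := rcos (th y x); rewrite /ball /= sub0r normrN ger0_norm // => /(_ yx).
rewrite cos0 ger0_norm ?subr_ge0 ?cos_le1 // => cosxy.
have := lip y x; rewrite in_itv /= andbT => lipyx.
suff : - e < f y - f x by rewrite /e; lra.
by have : (f y - f x) ^+ 2 < e ^+ 2 by [lra]; nra.
Qed.

Lemma cos_theta_measurable :
  measurable_fun setT (fun z : B * B => cos (th z.1 z.2)).
Proof.
have [I [e [a [b [cosE lip]]]]] := cos_embedding geometry.
under eq_fun do rewrite cosE.
apply: measurable_funD => //; apply: measurable_funM => //.
apply: measurable_sum => i; apply: measurable_funM.
  by apply: (measurableT_comp (lipschitz_measurable (lip i))); exact: measurable_fst.
by apply: (measurableT_comp (lipschitz_measurable (lip i))); exact: measurable_snd.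
Qed.

Lemma cos_theta_measurable2 (y : X) :
  measurable_fun setT (fun x : B => cos (th x y)).
Proof. exact: (@measurable_fun_pair1 _ _ _ B B _ _ y cos_theta_measurable). Qed.

Variable mu : probability B R.
Hypothesis mu_invariant : isometry_invariant mu.

Definition cos_difference (y1 y2 : X) (x : B) : R := `|cos (th x y1) - cos (th x y2)|.

Lemma cos_difference_measurable y1 y2 : measurable_fun setT (cos_difference y1 y2).
Proof.
apply: measurableT_comp => //.
by apply: measurable_funB; exact: cos_theta_measurable2.
Qed.

(** Membership in the balls is phrased by cosines, decreasing on [[0, pi]], so that joint
    measurability follows from that of [cos theta]. *)
Definition ball_difference (y1 y2 : X) : set (measurableTypeR R * B) :=
  [set z | (0 <= z.1 <= pi) &&
           ((cos z.1 < cos (th z.2 y1)) (+) (cos z.1 < cos (th z.2 y2)))].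

Lemma ball_difference_measurable y1 y2 : measurable (ball_difference y1 y2).
Proof.
have mcos : measurable_fun setT (fun z : measurableTypeR R * B => cos z.1).
  apply: (@measurableT_comp _ _ _ _ _ _ cos); last exact: measurable_fst.
  exact: (continuous_measurable_fun (@continuous_cos R)).
have mth y : measurable_fun setT (fun z : measurableTypeR R * B => cos (th z.2 y)).
  apply: (@measurableT_comp _ _ _ _ _ _ (fun x : B => cos (th x y))).
    exact: cos_theta_measurable2.
  exact: measurable_snd.
have mball y := measurable_fun_ltr mcos (mth y).
have mitv : measurable_fun setT (fun z : measurableTypeR R * B => 0 <= z.1 <= pi).
  by apply: measurable_and; apply: measurable_fun_ler => //; exact: measurable_fst.
pose P y (z : measurableTypeR R * B) := cos z.1 < cos (th z.2 y).
have -> : ball_difference y1 y2 =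
    (fun z : measurableTypeR R * B => 0 <= z.1 <= pi) @^-1` [set true] `&`
    ((P y1 @^-1` [set true] `&` P y2 @^-1` [set false]) `|`
     (P y1 @^-1` [set false] `&` P y2 @^-1` [set true])).
  apply/seteqP; split => z; rewrite /ball_difference /P /=.
    by move=> /andP[->]; case: (_ < _); case: (_ < _) => //= _; split => //;
      [left|right].
  by move=> [-> [[-> ->]|[-> ->]]].
apply: measurableI; first by rewrite -[X in measurable X]setTI; exact: mitv.
by apply: measurableU; apply: measurableI;
  rewrite -[X in measurable X]setTI; exact: mball.
Qed.

Lemma geo_ball_difference y1 y2 r : 0 <= r <= pi ->
  geo_ball y1 r `+` geo_ball y2 r = xsection (ball_difference y1 y2) r.
Proof.
move=> r0pi; have cosE (x y : X) : (cos r < cos (th x y)) = (th x y < r).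
  by rewrite ltr_cos ?in_itv //= theta_itv.
apply/seteqP; split => x; rewrite /xsection /= inE /ball_difference /= !cosE r0pi
  /= /geo_ball /setY /setU /setD /=.
  by move=> [[-> /negP/negbTE ->]|[-> /negP/negbTE ->]].
by case: (_ < r); case: (_ < r) => //= _; [left|right].
Qed.

(** Two iterated integrals of the indicator of [ball_difference]: its sections at fixed [r] are
    symmetric differences of balls, those at fixed [x] are computed by [xi_natural_between]. *)
Lemma theta_delta_cos y1 y2 : theta_delta mu (@xi_natural R) y1 y2 =
  2^-1 * fine (\int[mu]_x (cos_difference y1 y2 x)%:E)%E.
Proof.
rewrite /theta_delta /Rintegral; congr (_ * fine _).
pose f z : \bar R := (\1_(ball_difference y1 y2) z)%:E.
transitivity (\int[@xi_natural R]_r \int[mu]_x f (r, x))%E.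
  rewrite integral_mkcond; apply: eq_integral => r _; rewrite patchE.
  rewrite /f; case: ifPn => [|/negP]; rewrite inE /= in_itv /= => r0pi; last first.
    rewrite integral0_eq // => x _; rewrite indicE memNset //.
    by rewrite /ball_difference /= => /andP[].
  rewrite geo_ball_difference //.
  have mS : measurable (xsection (ball_difference y1 y2) r).
    by apply: measurable_xsection; exact: ball_difference_measurable.
  rewrite fineK; last exact: fin_num_measure.
  rewrite -[X in mu X]setIT -integral_indic //.
  by apply: eq_integral => x _; rewrite !indicE mem_xsection.
rewrite (fubini_tonelli f) //; last 2 first.
- by apply/measurable_EFinP; apply: measurable_indic; exact: ball_difference_measurable.
- by move=> z; rewrite lee_fin.
apply: eq_integral => x _.
rewrite -xi_natural_between ?theta_itv //.
have -> : [set r | (0 <= r <= pi) && ((th x y1 < r) (+) (th x y2 < r))] =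
    ysection (ball_difference y1 y2) x.
  apply/seteqP; split => r; rewrite /ysection /= inE /ball_difference /=;
    by move=> /andP[r0pi]; rewrite r0pi !ltr_cos ?in_itv //= theta_itv.
rewrite -[X in xi_natural X]setIT -integral_indic //; last first.
  by apply: measurable_ysection; exact: ball_difference_measurable.
by apply: eq_integral => r _; rewrite /f !indicE mem_ysection.
Qed.

Lemma integral_isometry (g : X -> X) (f : B -> \bar R) : isometry g ->
  measurable_fun setT f -> (forall x, (0 <= f x)%E) ->
  (\int[mu]_x f (g x) = \int[mu]_x f x)%E.
Proof.
move=> ig mf f0; have mg := isometry_measurable ig.
have := @ge0_integral_pushforward _ _ _ _ _ _ mg mu _ f measurableT mf.
rewrite preimage_setT => <-; last by move=> x _; exact: f0.
apply: eq_measure_integral => A mA _.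
by case: ig => bg gE; exact: mu_invariant.
Qed.

Let tauE (x y : X) : tau x y = Num.sqrt ((1 - cos (th x y)) / 2).
Proof. by apply: tau_cos; exact: theta_itv. Qed.

Lemma tau_ge0 (x y : X) : 0 <= tau x y.
Proof. by rewrite tauE sqrtr_ge0. Qed.

Lemma tau_le1 (x y : X) : tau x y <= 1.
Proof. by rewrite /tau sin_le1. Qed.

Lemma tau_measurable : measurable_fun setT (fun z : B * B => tau z.1 z.2).
Proof.
under eq_fun do rewrite tauE.
apply: (@measurableT_comp _ _ _ _ _ _ (@Num.sqrt R)).
  by apply: continuous_measurable_fun; exact: sqrt_continuous.
apply: measurable_funM => //; apply: measurable_funB => //.
exact: cos_theta_measurable.
Qed.

Lemma tau_measurable2 (x : X) : measurable_fun setT (fun y : B => tau x y).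
Proof. exact: (@measurable_fun_pair2 _ _ _ B B _ _ x tau_measurable). Qed.

Lemma theta_delta_tau : exists2 c : R, 0 < c &
  forall y1 y2, theta_delta mu (@xi_natural R) y1 y2 = c * tau y1 y2.
Proof.
have [a [b [_ orbit]]] := difference_orbit geometry.
pose I y1 y2 : \bar R := (\int[mu]_x (cos_difference y1 y2 x)%:E)%E.
have mI y1 y2 : measurable_fun setT (fun x : B => (cos_difference y1 y2 x)%:E).
  by apply/measurable_EFinP; exact: cos_difference_measurable.
have I_ge0 y1 y2 : (0 <= I y1 y2)%E.
  by apply: integral_ge0 => x _; rewrite lee_fin normr_ge0.
have Ifin y1 y2 : I y1 y2 \is a fin_num.
  rewrite ge0_fin_numE //; apply: (@le_lt_trans _ _ (\int[mu]_x 2%:E)%E).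
    apply: ge0_le_integral => //; first by move=> x _; rewrite lee_fin normr_ge0.
    move=> x _; rewrite lee_fin /cos_difference /=.
    have := cos_le1 (th x y1); have := cos_geN1 (th x y1).
    have := cos_le1 (th x y2); have := cos_geN1 (th x y2).
    by move=> *; rewrite ler_norml; apply/andP; split; lra.
  by rewrite integral_probability_cst ltry.
(* The orbit property rescales the integrand and transports it by [g]; invariance of [mu] removes
   [g]. *)
have Itau y1 y2 : I y1 y2 = ((tau y1 y2)%:E * I a b)%E.
  have [g ig gE] := orbit y1 y2; rewrite /I.
  rewrite -(integral_isometry ig (mI a b)) => [|x]; last by rewrite lee_fin normr_ge0.
  rewrite -ge0_integralZl_EFin ?tau_ge0 //.
  - by apply: eq_integral => x _; rewrite -EFinM /cos_difference gE.
  - by move=> x _; rewrite lee_fin normr_ge0.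
  - exact: (measurableT_comp (mI a b) (isometry_measurable ig)).
exists (fine (I a b) / 2); last first.
  move=> y1 y2; rewrite theta_delta_cos -/(I _ _) Itau fineM // /=.
  by field.
rewrite divr_gt0 // fine_gt0 // -ge0_fin_numE // Ifin andbT.
(* If [I a b] were zero, every [I y1 y2] would be. But the sum of [cos_difference] over the finitely
   many separating pairs is positive everywhere. *)
rewrite lt_neqAle I_ge0 andbT; apply/eqP => /esym I0.
have Iall y1 y2 : I y1 y2 = 0%E by rewrite Itau I0 mule0.
have [s sP] := separating_pairs geometry.
suff : (0 < \int[mu]_x (\sum_(p <- s) cos_difference p.1 p.2 x)%:E)%E.
  under eq_integral do rewrite -sumEFin.
  rewrite ge0_integral_sum //; last by move=> p x _; rewrite lee_fin normr_ge0.
  by rewrite big1 ?ltxx // => p _; exact: Iall.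
apply: integral_gt0 => [|x].
  by apply: measurable_sum => p; exact: cos_difference_measurable.
rewrite lt_neqAle eq_sym sumr_ge0 ?andbT; last by move=> p _; exact: normr_ge0.
have [p ps px] := sP x; rewrite psumr_neq0; last by move=> q _; exact: normr_ge0.
by apply/hasP; exists p => //=; rewrite normr_gt0 subr_eq0.
Qed.

(** By transitivity the inner integral [m x] does not depend on [x], so it is the mean of [tau]. It
    is positive because [tau a y + tau b y] never vanishes when [tau a b = 1]. *)
Lemma mean_scale (c : R) (rho : X -> X -> R) : 0 < c ->
  (forall x y, rho x y = c * tau x y) ->
  mean mu rho = c * mean mu (@tau R Q) /\ 0 < mean mu (@tau R Q).
Proof.
move=> c0 rhoE; have [p0 trans] := isometry_transitive geometry.
pose m (x : X) : \bar R := (\int[mu]_y (tau x y)%:E)%E.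
have mtau x : measurable_fun setT (fun y : B => (tau x y)%:E).
  by apply/measurable_EFinP; exact: tau_measurable2.
have mo x : m x = m p0.
  have [g ig gx] := trans x; rewrite /m -(integral_isometry ig (mtau p0)).
    by apply: eq_integral => y _; case: ig => _ gE; rewrite /tau -gx gE.
  by move=> y; rewrite lee_fin tau_ge0.
have meanE : (\int[(mu \x mu)%E]_z (tau z.1 z.2)%:E)%E = m p0.
  rewrite (@fubini_tonelli1 _ _ _ _ _ mu mu (fun z => (tau z.1 z.2)%:E)) //.
  - under eq_integral do rewrite /fubini_F /= -/(m _) mo.
    by rewrite integral_probability_cst.
  - by apply/measurable_EFinP; exact: tau_measurable.
  - by move=> z; rewrite lee_fin tau_ge0.
have m_ge0 : (0 <= m p0)%E by apply: integral_ge0 => y _; rewrite lee_fin tau_ge0.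
have mfin : m p0 \is a fin_num.
  rewrite ge0_fin_numE //; apply: (@le_lt_trans _ _ (\int[mu]_x 1%:E)%E).
    apply: ge0_le_integral => //; first by move=> y _; rewrite lee_fin tau_ge0.
    by move=> y _; rewrite lee_fin tau_le1.
  by rewrite integral_probability_cst ltry.
split; last first.
  rewrite /mean /Rintegral meanE fine_gt0 // -ge0_fin_numE // mfin andbT.
  have [a [b [tab _]]] := difference_orbit geometry.
  suff : (0 < m p0 + m p0)%E.
    move=> mm; rewrite lt_neqAle m_ge0 andbT; apply/eqP => m0.
    by move: mm; rewrite -m0 adde0 ltxx.
  rewrite -{1}(mo a) -(mo b) /m -ge0_integralD //;
    try by move=> y _; rewrite lee_fin tau_ge0.
  under eq_integral do rewrite -EFinD.
  apply: integral_gt0 => [|y].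
    by apply: measurable_funD; exact: tau_measurable2.
  rewrite lt_neqAle addr_ge0 ?tau_ge0 // andbT eq_sym paddr_eq0 ?tau_ge0 //.
  apply/negP => /andP[/eqP ay /eqP/(tau_eq0 geometry) yb].
  by move: tab; rewrite yb ay => /esym/eqP; rewrite oner_eq0.
rewrite /mean /Rintegral.
transitivity (fine (\int[(mu \x mu)%E]_z (c%:E * (tau z.1 z.2)%:E))%E).
  by congr fine; apply: eq_integral => z _; rewrite rhoE.
rewrite ge0_integralZl_EFin ?ltW //.
- by rewrite meanE fineM.
- by move=> z _; rewrite lee_fin tau_ge0.
- by apply/measurable_EFinP; exact: tau_measurable.
Qed.

Lemma rank_one_chordal : exists gamma : R,
  [/\ gamma = mean mu (@tau R Q) / mean mu (theta_delta mu (@xi_natural R)),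
      gamma = diam (@tau R Q) / diam (theta_delta mu (@xi_natural R))
    & forall x1 x2 : X, tau x1 x2 = gamma * theta_delta mu (@xi_natural R) x1 x2].
Proof.
have [c c0 cE] := theta_delta_tau.
have [meanE mean0] := mean_scale c0 cE.
have [a [b [tab _]]] := difference_orbit geometry.
(* Both quotients equal [1 / c]: the mean of [tau] is nonzero, and both suprema are attained at
   [a, b], where [tau] is [1]. *)
exists c^-1; split.
- by rewrite meanE; field; rewrite !gt_eqF.
- have -> : diam (@tau R Q) = 1.
    apply: sup_attained; first by exists a => //; exists b.
    by move=> _ [x _ [y _ <-]]; exact: tau_le1.
  have -> : diam (theta_delta mu (@xi_natural R)) = c.
    apply: sup_attained; first by exists a => //; exists b => //; rewrite cE tab mulr1.
    by move=> _ [x _ [y _ <-]]; rewrite cE ler_piMr ?tau_le1 // ltW.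
  by rewrite mul1r.
- by move=> x y; rewrite cE mulrA mulVf ?mul1r // gt_eqF.
Qed.

End RankOneAnalysis.

(** * Spheres *)

Section SphereGeometry.
Variables (R : realType) (d : nat) (d1 : (1 <= d)%N).
Notation V := 'rV[R]_d.+1.
Notation S := (sphere R d).
Notation Q := (Sphere d1).

Lemma dotC (x y : V) : dot x y = dot y x.
Proof. by apply: eq_bigr => i _; rewrite mulrC. Qed.

Lemma dotDl (x y z : V) : dot (x + y) z = dot x z + dot y z.
Proof. by rewrite /dot -big_split; apply: eq_bigr => i _; rewrite !mxE mulrDl. Qed.

Lemma dotZl a (x z : V) : dot (a *: x) z = a * dot x z.
Proof. by rewrite /dot mulr_sumr; apply: eq_bigr => i _; rewrite !mxE mulrA. Qed.

Lemma dotNl (x z : V) : dot (- x) z = - dot x z.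
Proof. by rewrite -scaleN1r dotZl mulN1r. Qed.

Lemma dotDr (x y z : V) : dot z (x + y) = dot z x + dot z y.
Proof. by rewrite !(dotC z) dotDl. Qed.

Lemma dotNr (x z : V) : dot z (- x) = - dot z x.
Proof. by rewrite !(dotC z) dotNl. Qed.

Lemma dotZr a (x z : V) : dot z (a *: x) = a * dot z x.
Proof. by rewrite !(dotC z) dotZl. Qed.

Lemma dot_ge0 (x : V) : 0 <= dot x x.
Proof. by apply: sumr_ge0 => i _; rewrite -expr2 sqr_ge0. Qed.

Lemma dot_eq0 (x : V) : (dot x x == 0) = (x == 0).
Proof.
apply/idP/eqP => [|->]; last by rewrite /dot big1 // => i _; rewrite mxE mul0r.
rewrite psumr_eq0 => [/allP x0|i _]; last by rewrite -expr2 sqr_ge0.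
apply/rowP => i; rewrite mxE; have := x0 i.
by rewrite mem_index_enum mulf_eq0 orbb => /(_ isT)/eqP.
Qed.

Lemma sphere_unit (x : V) : (Num.sqrt (dot x x) == 1) = (dot x x == 1).
Proof.
apply/eqP/eqP => [xE|->]; last exact: sqrtr1.
by rewrite -(sqr_sqrtr (dot_ge0 x)) xE expr1n.
Qed.

Lemma sphere_dot (x : S) : dot (sval x) (sval x) = 1.
Proof. by case: x => x /= xS; apply/eqP; rewrite -sphere_unit. Qed.

Definition sphere_mk (x : V) (x1 : dot x x = 1) : S :=
  exist (fun x : V => Num.sqrt (dot x x) == 1) x
    (etrans (sphere_unit x) (introT eqP x1)).

Lemma sphere_inj (x y : S) : sval x = sval y -> x = y.
Proof.
case: x y => [x px] [y py] /= xy; rewrite xy in px *.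
by congr exist; exact: bool_irrelevance.
Qed.

Lemma sphere_dist (x y : S) :
  dot (sval x - sval y) (sval x - sval y) = 2 * (1 - dot (sval x) (sval y)).
Proof.
rewrite !(dotDl, dotDr, dotNl, dotNr) !sphere_dot (dotC (sval y)); ring.
Qed.

Lemma sphere_dot_itv (x y : S) : -1 <= dot (sval x) (sval y) <= 1.
Proof.
have := dot_ge0 (sval x - sval y); rewrite sphere_dist.
have := dot_ge0 (sval x + sval y).
rewrite !(dotDl, dotDr) !sphere_dot (dotC (sval y)) => *.
by apply/andP; split; lra.
Qed.

Lemma sphere_cos (x y : carrier R Q) : cos (theta x y) = dot (sval x) (sval y).
Proof. by rewrite acosK // in_itv /= sphere_dot_itv. Qed.

(** The Householder reflection along [n = x - y]; it sends [x] to [y] because [2 <x, n> = <n, n>]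
    for unit vectors. *)
Lemma sphere_transitive (x y : S) : exists2 g : S -> S,
  bijective g /\ (forall z w, dot (sval (g z)) (sval (g w)) = dot (sval z) (sval w)) &
  g x = y.
Proof.
have [xy|xy] := eqVneq x y; first by exists id => //; split => //; exists id.
pose n := sval x - sval y.
have n0 : dot n n != 0.
  by rewrite dot_eq0 subr_eq0; apply: contraNneq xy => /sphere_inj ->.
have nE : dot n n = 2 * dot (sval x) n.
  by rewrite sphere_dist /n dotDr dotNr sphere_dot.
have xn : sval x - n = sval y by rewrite /n opprB addrC subrK.
move: n n0 nE xn => n n0 nE xn.
pose h (z : V) := z - (2 * dot z n / dot n n) *: n.
have hdot z w : dot (h z) (h w) = dot z w.
  rewrite /h !(dotDl, dotDr, dotNl, dotNr, dotZl, dotZr) (dotC n w); field.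
  exact: n0.
have hK z : h (h z) = z.
  rewrite {1}/h.
  have -> : dot (h z) n = - dot z n.
    by rewrite /h dotDl dotNl dotZl divfK //; ring.
  by rewrite mulrN mulNr scaleNr opprK /h subrK.
have h1 (z : S) : dot (h (sval z)) (h (sval z)) = 1 by rewrite hdot sphere_dot.
pose g (z : S) := sphere_mk (h1 z).
have gK : involutive g by move=> z; apply: sphere_inj; rewrite /= hK.
exists g; first by split=> [|z w]; [exact: inv_bij|rewrite /= hdot].
apply: sphere_inj; rewrite /= /h.
by rewrite -nE divff // scale1r.
Qed.

Lemma sphere_isometry (g : S -> S) : bijective g ->
  (forall z w, dot (sval (g z)) (sval (g w)) = dot (sval z) (sval w)) ->
  isometry (Q := Q) g.
Proof. by move=> bg gE; split => // x y; rewrite /theta gE. Qed.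

Lemma dot_delta (x : V) i : dot x (delta_mx 0 i) = x 0 i.
Proof.
rewrite /dot (bigD1 i) //= big1 ?addr0; first by rewrite mxE !eqxx mulr1.
by move=> j /negbTE ji; rewrite mxE ji andbF mulr0.
Qed.

Lemma sphere_geometry : rank_one_geometry R Q.
Proof.
have e1 i : dot (delta_mx 0 i : V) (delta_mx 0 i) = 1.
  by rewrite dot_delta mxE !eqxx.
have eN1 i : dot (- delta_mx 0 i : V) (- delta_mx 0 i) = 1.
  by rewrite dotNl dotNr opprK.
pose e i := sphere_mk (e1 i); pose e' i := sphere_mk (eN1 i).
have th_itv (x y : carrier R Q) : 0 <= theta x y <= pi.
  by rewrite /theta acos_ge0 ?acos_lepi // sphere_dot_itv.
have tauE (x y : carrier R Q) : tau x y = Num.sqrt ((1 - dot (sval x) (sval y)) / 2).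
  by rewrite tau_cos // sphere_cos.
split=> //.
- move=> x y; rewrite tauE => /eqP; rewrite sqrtr_eq0 => xy.
  apply: sphere_inj; apply/eqP; rewrite -subr_eq0 -dot_eq0 sphere_dist.
  by have /andP[_] := sphere_dot_itv x y => xy1; apply/eqP; lra.
- exists 'I_d.+1, (fun i (x : S) => sval x 0 i), 1, 0; split=> [x y|i x y].
    by rewrite sphere_cos mul1r addr0.
  rewrite sphere_cos -sphere_dist /dot (bigD1 i) //= !mxE -expr2 lerDl.
  by apply: sumr_ge0 => j _; rewrite -expr2 sqr_ge0.
(* Antipodal points, whose difference is twice the unit vector [e 0]. *)
- exists (e 0), (e' 0); split.
    rewrite tauE /= dotNr e1 opprK; have -> : (1 + 1) / 2 = 1 :> R by field.
    exact: sqrtr1.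
  move=> y1 y2; pose v := sval y1 - sval y2.
  have v2 : dot v v = 4 * tau y1 y2 ^+ 2.
    rewrite tauE sqr_sqrtr; first by rewrite sphere_dist; field.
    by have /andP[_] := sphere_dot_itv y1 y2 => ?; rewrite divr_ge0 //; lra.
  have diffE (x : carrier R Q) : cos (theta x y1) - cos (theta x y2) = dot (sval x) v.
    by rewrite !sphere_cos dotDr dotNr.
  have t0 : 0 <= tau y1 y2 by rewrite tauE sqrtr_ge0.
  have [t00|tn0] := eqVneq (tau y1 y2) 0.
    exists id; first by split => //; exists id.
    move=> x; rewrite diffE t00 mul0r; move: v2; rewrite t00 expr0n mulr0 => /eqP.
    by rewrite dot_eq0 => /eqP ->; rewrite -(subrr 0) dotDr dotNr subrr normr0.
  (* The vector [v] has length [2 tau], so its normalization is a point of the sphere, which an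
     isometry carries to [e 0]. *)
  have w1 : dot ((2 * tau y1 y2)^-1 *: v) ((2 * tau y1 y2)^-1 *: v) = 1.
    by rewrite dotZl dotZr v2; field.
  have [g [bg gE] gw] := sphere_transitive (sphere_mk w1) (e 0).
  exists g; first exact: sphere_isometry.
  move=> x; rewrite diffE !sphere_cos dotNr opprK.
  have -> : dot (sval (g x)) (delta_mx 0 0) = (2 * tau y1 y2)^-1 * dot (sval x) v.
    by rewrite -[delta_mx 0 0]/(sval (e 0)) -gw gE /= dotZr.
  rewrite -[X in X * _](ger0_norm t0) -normrM; by congr `|_|; field.
(* The two cosines for the [i]-th pair differ by twice the [i]-th coordinate of [x], and some
   coordinate is nonzero. *)
- exists [seq (e i, e' i) | i <- enum 'I_d.+1] => x.
  have [i xi] : exists i, sval x 0 i != 0.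
    apply/existsP; apply: contraT => /existsPn x0.
    have := sphere_dot x; rewrite /dot big1 => [/esym/eqP|i _].
      by rewrite oner_eq0.
    by have := x0 i; rewrite negbK => /eqP ->; rewrite mul0r.
  exists (e i, e' i); first by apply: map_f; rewrite mem_enum.
  by rewrite !sphere_cos /= dotNr dot_delta -subr_eq0 opprK -mulr2n mulrn_eq0.
- exists (e 0) => x; have [g [bg gE] gx] := sphere_transitive x (e 0).
  by exists g => //; exact: sphere_isometry.
Qed.

End SphereGeometry.

(** * Projective spaces *)

Section CayleyDicksonBasis.
Variable R : realType.

Fixpoint cd_basis (k : nat) : seq (cd R k) :=
  match k return seq (cd R k) with
  | 0 => [:: (1 : R)]
  | k'.+1 => [seq ((b, 0) : cd R k'.+1) | b <- cd_basis k'] ++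
             [seq ((0, b) : cd R k'.+1) | b <- cd_basis k']
  end.

Lemma cd_dot_basis k (x y : cd R k) :
  cd_dot x y = \sum_(b <- cd_basis k) cd_dot x b * cd_dot y b.
Proof.
elim: k x y => [|k IH] x y /=; first by rewrite big_seq1 !mulr1.
rewrite big_cat !big_map /= (IH x.1 y.1) (IH x.2 y.2).
have dot0 (z : cd R k) : cd_dot z 0 = 0 by rewrite cd_dotC cd_dot0l.
by congr (_ + _); apply: eq_bigr => b _ /=; rewrite !dot0 ?addr0 ?add0r.
Qed.

Lemma cd_basis_unit k (b : cd R k) : b \in cd_basis k -> cd_dot b b = 1.
Proof.
elim: k b => [|k IH] b /=; first by rewrite inE => /eqP ->; rewrite mulr1.
by rewrite mem_cat => /orP[] /mapP[c /IH cc ->] /=; rewrite cc cd_dot0l ?addr0 ?add0r.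
Qed.

Lemma cd_dot_le_basis k (x b : cd R k) :
  b \in cd_basis k -> cd_dot x b ^+ 2 <= cd_dot x x.
Proof.
move=> bk; rewrite [leRHS]cd_dot_basis (big_rem b) //= -expr2 lerDl.
by apply: sumr_ge0 => c _; rewrite -expr2 sqr_ge0.
Qed.

End CayleyDicksonBasis.

Section ProjectiveGeometry.
Variables (R : realType) (F : division_algebra) (n : nat).
Hypotheses (n2 : (2 <= n)%N) (octonion_plane : F = Octonions -> n = 2%N).
Notation X := (projective R F n).
Notation Q := (Projective n2 octonion_plane).
Notation k := (cd_level F).
Local Notation K x y := (herm_inner (sval x) (sval y)).
Implicit Types (x y z : X) (i j l : 'I_n.+1).

Let k3 := cd_level_le3 F.

Lemma projective_hermitian x : hermitian (sval x).
Proof. exact/is_projection_hermitian/projective_is_projection. Qed.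

Lemma herm_innerC x y : K x y = K y x.
Proof.
rewrite !herm_innerE ?projective_hermitian //.
by apply: eq_bigr => i _; apply: eq_bigr => l _; rewrite cd_dotC.
Qed.

Lemma row_eq0 x i l : diag_entry x i = 0 -> sval x i l = 0.
Proof. exact/projection_row0/projective_is_projection. Qed.

(** A zero diagonal entry of [y] kills its row and column, so only the block at [i, j] contributes,
    and its two off-diagonal terms agree. *)
Lemma herm_inner_block i j x y : i != j ->
  (forall l, l != i -> l != j -> diag_entry y l = 0) ->
  K x y = diag_entry x i * diag_entry y i + diag_entry x j * diag_entry y j
          + 2 * cd_dot (sval x i j) (sval y i j).
Proof.
move=> ij y0; have hx := projective_hermitian x; have hy := projective_hermitian y.
have ji : j != i by rewrite eq_sym.
have diagE l : cd_dot (sval x l l) (sval y l l) = diag_entry x l * diag_entry y l.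
  rewrite (diag_real l hx) cd_dotZl cd_dotC cd_dot1; congr (_ * _).
have row0 a l : l != i -> l != j -> cd_dot (sval x a l) (sval y a l) = 0.
  move=> li lj; rewrite cd_dotC.
  by rewrite (hermitianE a l hy) row_eq0 ?y0 // cd_conj0 cd_dot0l.
rewrite herm_innerE // (bigD1 i) // (bigD1 j) //=.
rewrite [X in _ + (_ + X)]big1 ?addr0 => [|a /andP[ai aj]]; last first.
  by rewrite big1 // => l _; rewrite cd_dotC row_eq0 ?y0 // cd_dot0l.
have rowE a : \sum_l cd_dot (sval x a l) (sval y a l) =
    cd_dot (sval x a i) (sval y a i) + cd_dot (sval x a j) (sval y a j).
  rewrite (bigD1 i) // (bigD1 j) //= big1 ?addr0 // => l /andP[li lj].
  exact: row0.
rewrite !rowE !diagE (hermitianE j i hx) (hermitianE j i hy) cd_dot_conj; ring.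
Qed.

Lemma diag_entry_other x i l : diag_entry x i = 1 -> l != i -> diag_entry x l = 0.
Proof.
move=> xi li; have := diag_entry_sum x; rewrite (bigD1 i) //= xi => /eqP.
rewrite -subr_eq0 addrAC subrr add0r psumr_eq0 => [/allP/(_ l)|j _]; last first.
  exact: diag_entry_ge0.
by rewrite mem_index_enum li /= => /(_ isT)/eqP.
Qed.

Let i0 : 'I_n.+1 := ord0.
Let i1 : 'I_n.+1 := Ordinal (leqW n2 : 1 < n.+1)%N.
Let i01 : i0 != i1. Proof. by []. Qed.

Lemma herm_inner_vertex i x y : diag_entry y i = 1 -> K x y = diag_entry x i.
Proof.
move=> yi; have [j ij] : exists j, i != j.
  by have [->|] := eqVneq i i0; [exists i1|exists i0].
rewrite (@herm_inner_block i j) // => [|l li _]; last exact: diag_entry_other yi li.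
have yj : diag_entry y j = 0 by apply: diag_entry_other yi _; rewrite eq_sym.
rewrite yi yj (hermitianE i j (projective_hermitian y)) (row_eq0 _ yj).
by rewrite cd_conj0 cd_dotC cd_dot0l; ring.
Qed.

Lemma vertex_exists i : exists x, diag_entry x i = 1.
Proof.
have [j ij] : exists j, i != j.
  by have [->|] := eqVneq i i0; [exists i1|exists i0].
have [g _ [gi _ _]] := normal_form octonion_plane (point : X) point ij.
by exists (g point).
Qed.

(** For nonnegativity, an isometry moves [x] to a coordinate projection, where the scalar product
    becomes a diagonal entry. *)
Lemma herm_inner_itv x y : 0 <= K x y <= 1.
Proof.
rewrite herm_inner_le1 ?projective_is_projection // andbT.
have [g [_ gE] [gx _ _]] := normal_form octonion_plane x y i01.
by rewrite herm_innerC -gE (@herm_inner_vertex i0) // diag_entry_ge0.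
Qed.

Lemma projective_theta_itv (x y : carrier R Q) : 0 <= theta x y <= pi.
Proof.
have /andP[K0 K1] := herm_inner_itv x y; rewrite /theta.
have sK : Num.sqrt (K x y) <= 1 by rewrite -sqrtr1 ler_wsqrtr.
have sitv : -1 <= Num.sqrt (K x y) <= 1.
  by rewrite sK andbT (le_trans _ (sqrtr_ge0 _)) // lerN10.
rewrite mulr_ge0 ?acos_ge0 //=; set t := acos _.
suff : t <= pi / 2 by lra.
rewrite leNgt; apply/negP => tpi; have : cos t < cos (pi / 2).
  by rewrite ltr_cos // in_itv /= ?acos_ge0 ?acos_lepi //; have := pi_ge0 R; lra.
by rewrite acosK ?in_itv // cos_pihalf ltNge sqrtr_ge0.
Qed.

Lemma projective_cos (x y : carrier R Q) : cos (theta x y) = 2 * K x y - 1.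
Proof.
have /andP[K0 K1] := herm_inner_itv x y; rewrite /theta.
rewrite mulr_natl cos_mulr2n acosK ?sqr_sqrtr //; first by rewrite mulr_natl.
rewrite in_itv /= -sqrtr1 ler_wsqrtr // andbT.
by rewrite sqrtr1 (le_trans _ (sqrtr_ge0 _)) // lerN10.
Qed.

Lemma projective_tau (x y : carrier R Q) : tau x y = Num.sqrt (1 - K x y).
Proof.
by rewrite tau_cos ?projective_theta_itv // projective_cos; congr Num.sqrt; field.
Qed.

Lemma projective_isometry_theta (g : X -> X) :
  projective_isometry g -> isometry (Q := Q) g.
Proof. by move=> [bg gE]; split => // x y; rewrite /theta gE. Qed.

(** The point [w] has block [1 / 2] times [[1, u; u^*, 1]]: a vertex turned by half a right angle,
    then given the phase [u]. Such points detect the off-diagonal entry of [x]. *)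
Lemma edge_point_exists (u : cd R k) : cd_dot u u = 1 -> exists w : X,
  forall x : X, K x w =
    (diag_entry x i0 + diag_entry x i1) / 2 + cd_dot (sval x i0 i1) u.
Proof.
move=> u1; have [v v1] := vertex_exists i0.
have [c [s [cs1 c2 s2]]] : exists c s : R,
    [/\ c ^+ 2 + s ^+ 2 = 1, c ^+ 2 - s ^+ 2 = 0 & 2 * (c * s) = 1].
  by apply: half_angle; rewrite expr0n expr1n add0r.
have v0 l j : l != i0 -> sval v l j = 0.
  by move=> li; rewrite row_eq0 //; exact: diag_entry_other v1 li.
have v01 : sval v i0 i1 = 0.
  by rewrite (hermitianE _ _ (projective_hermitian v)) v0 // cd_conj0.
have [r ir rE] := @reflect_isometry R F n _ _ _ _ i01 cs1.
have [g ig gE] := phase_isometry octonion_plane i01 u1.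
have hv := projective_hermitian v.
have dr0 : diag_entry (r v) i0 = 2^-1.
  rewrite /diag_entry rE reflect_mx_diagi // v01 (v0 i1 i1) // -/(diag_entry v i0) v1.
  rewrite -!cd_dot1 !cd_dot0l; lra.
have dr1 : diag_entry (r v) i1 = 2^-1.
  rewrite /diag_entry rE reflect_mx_diagj // v01 (v0 i1 i1) // -/(diag_entry v i0) v1.
  rewrite -!cd_dot1 !cd_dot0l; lra.
have r01 : sval (r v) i0 i1 = cd_scale 2^-1 (cd_one R k).
  rewrite rE !mxE !eqxx /= v01 !(v0 i1) // !cd_scaler0 !addr0 !cd_scaleA.
  rewrite (diag_real _ hv) -/(diag_entry v i0) v1 cd_scale1.
  by rewrite cd_scaler0 addr0; congr cd_scale; lra.
have dr l : l != i0 -> l != i1 -> diag_entry (g (r v)) l = 0.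
  move=> l0 l1; rewrite (gE _).2 /diag_entry rE reflect_mx_diag // v0 //.
  by rewrite -cd_dot1 cd_dot0l.
exists (g (r v)) => x; rewrite (herm_inner_block _ i01 dr) !(gE _).2 dr0 dr1 (gE _).1.
by rewrite r01 cd_mulZr cd_mul1r cd_dotZr; field.
Qed.

(** In normal form [y1 - y2] has block [[q, - t; - t, - q]], whose square is [q] times the identity
    since [t ^ 2 = p q] and [p + q = 1]. A real reflection turns it into [tau] times the difference
    of two vertices. *)
Lemma projective_difference_orbit (a b : X) :
  diag_entry a i0 = 1 -> diag_entry b i1 = 1 ->
  forall y1 y2 : carrier R Q, exists2 g, isometry (Q := Q) g & forall x : carrier R Q,
    `|cos (theta x y1) - cos (theta x y2)| =
    tau y1 y2 * `|cos (theta (g x) (a : carrier R Q)) -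
                  cos (theta (g x) (b : carrier R Q))|.
Proof.
move=> a1 b1 y1 y2.
have [g [bg gE] [g1 g2 greal]] := normal_form octonion_plane y1 y2 i01.
have ig : projective_isometry g by [].
pose p := diag_entry (g y2) i0; pose q := diag_entry (g y2) i1.
pose t := cd_re (sval (g y2) i0 i1).
have pq1 : p + q = 1.
  rewrite -(diag_entry_sum (g y2)) (bigD1 i0) // (bigD1 i1) //= big1 ?addr0 //.
  by move=> l /andP[l0 l1]; exact: g2.
have q0 : 0 <= q by exact: diag_entry_ge0.
have tpq : t ^+ 2 = p * q.
  by rewrite -projection_minor ?projective_is_projection // cd_dot_real.
have tauE : tau y1 y2 = Num.sqrt q.
  rewrite projective_tau herm_innerC -gE (herm_inner_vertex _ g1) -/p.
  by congr Num.sqrt; lra.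
pose A x := diag_entry (g x) i0; pose B x := diag_entry (g x) i1.
pose Z x := cd_re (sval (g x) i0 i1).
have diffE (x : carrier R Q) :
    cos (theta x y1) - cos (theta x y2) = 2 * (q * (A x - B x) - 2 * t * Z x).
  rewrite !projective_cos -(gE x y1) -(gE x y2) (herm_inner_vertex _ g1).
  rewrite (herm_inner_block _ i01 g2) -/(A x) -/(B x) -/p -/q.
  rewrite (cd_conj_real greal) cd_dotZr cd_dot1 -/t -/(Z x).
  have -> : p = 1 - q by lra.
  ring.
have abE (z : carrier R Q) :
    cos (theta z (a : carrier R Q)) - cos (theta z (b : carrier R Q)) =
    2 * (diag_entry z i0 - diag_entry z i1).
  rewrite !projective_cos (herm_inner_vertex _ a1) (herm_inner_vertex _ b1); ring.
(* For [q = 0] also [t = 0], and both sides vanish. *)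
have [q00|qn0] := eqVneq q 0.
  exists g; first exact: projective_isometry_theta.
  move=> x; rewrite diffE tauE q00 sqrtr0 !mul0r sub0r.
  have -> : t = 0 by apply/eqP; rewrite -sqrf_eq0 tpq q00 mulr0.
  by rewrite mulr0 mul0r oppr0 mulr0 normr0.
pose r := Num.sqrt q.
have r2 : r ^+ 2 = q by rewrite sqr_sqrtr.
have r0 : r != 0 by rewrite -sqrf_eq0 r2.
(* Dividing the block by its eigenvalue [r] gives [[r, - t / r; - t / r, - r]], which holds the
   cosine and sine of the doubled angle. *)
have [c [s [cs1 cE sE]]] : exists c s : R,
    [/\ c ^+ 2 + s ^+ 2 = 1, c ^+ 2 - s ^+ 2 = r & 2 * (c * s) = - (t / r)].
  apply: half_angle; rewrite sqrrN expr_div_n tpq r2 mulfK //; lra.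
have [h ih hE] := @reflect_isometry R F n _ _ _ _ i01 cs1.
exists (h \o g).
  by apply: projective_isometry_theta; exact: projective_isometry_comp.
move=> x; rewrite diffE tauE -/r -[X in _ = X * _](ger0_norm (sqrtr_ge0 q)) -normrM.
rewrite abE /= /diag_entry hE.
have hx := projective_hermitian (g x).
rewrite reflect_mx_diagi // reflect_mx_diagj // -/(Z x) sE.
congr `|_|; have -> : q * (A x - B x) = r ^+ 2 * (A x - B x) by rewrite r2.
have -> : c ^+ 2 = (1 + r) / 2 by lra.
have -> : s ^+ 2 = (1 - r) / 2 by lra.
rewrite -/r /A /B /diag_entry; field.
exact: r0.
Qed.

Lemma projective_geometry : rank_one_geometry R Q.
Proof.
have [v vE] := choice vertex_exists.
split.
- exact: projective_theta_itv.
- move=> x y; rewrite projective_tau => /eqP; rewrite sqrtr_eq0 => xy.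
  apply: projective_inj; apply: herm_inner_eq1; rewrite ?projective_is_projection //.
  by have /andP[_] := herm_inner_itv x y => xy1; apply/eqP; rewrite eq_le xy1; lra.
(* The embedding takes all real coordinates of all matrix entries. *)
- pose N := size (cd_basis R k).
  pose e i l (b : 'I_N) x := cd_dot (sval x i l) (nth 0 (cd_basis R k) b).
  exists ('I_n.+1 * ('I_n.+1 * 'I_N))%type, (fun p => e p.1 p.2.1 p.2.2).
  exists 2, (- 1); split=> [x y|[i [l b]] x y]; rewrite /= projective_cos.
    rewrite herm_innerE ?projective_hermitian //; congr (_ * _ - 1).
    rewrite -(pair_bigA _
      (fun i (p : 'I_n.+1 * 'I_N) => e i p.1 p.2 x * e i p.1 p.2 y)) /=.
    apply: eq_bigr => i _; rewrite -(pair_bigA _ (fun l b => e i l b x * e i l b y)) /=.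
    by apply: eq_bigr => l _; rewrite cd_dot_basis (big_nth 0) big_mkord.
  have bk : nth 0 (cd_basis R k) b \in cd_basis R k by exact: mem_nth.
  rewrite -cd_dotNl -cd_dotDl; apply: le_trans (cd_dot_le_basis _ bk) _.
  (* The total squared distance is [1 - cos theta], which leaves a factor [2] to spare. *)
  have := herm_inner_dist (projective_is_projection x) (projective_is_projection y).
  rewrite (bigD1 i) //= (bigD1 l) //=.
  have /andP[K0 K1] := herm_inner_itv x y.
  set S1 := \sum_(_ < _ | _) cd_dot _ _; set S2 := \sum_(_ < _ | _) _.
  have S10 : 0 <= S1 by apply: sumr_ge0 => ? _; exact: cd_dot_ge0.
  have S20 : 0 <= S2 by do 2![apply: sumr_ge0 => ? _]; exact: cd_dot_ge0.
  by lra.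
- exists (v i0), (v i1); split; last exact: projective_difference_orbit.
  rewrite projective_tau (herm_inner_vertex _ (vE i1)).
  rewrite (diag_entry_other (vE i0)) // subr0.
  exact: sqrtr1.
(* The edge points for [u] and [- u] isolate the coordinate along [u]. The pair chosen for other [u]
   is arbitrary: only basis elements, of norm [1], are used. *)
- have wE (u : cd R k) : exists w : X * X, cd_dot u u = 1 -> forall x,
      K x w.1 - K x w.2 = 2 * cd_dot (sval x i0 i1) u.
    have [u1|/eqP u1] := eqVneq (cd_dot u u) 1; last first.
      by exists (point, point) => /u1.
    have uN1 : cd_dot (- u) (- u) = 1 by rewrite cd_dotNl cd_dotNr opprK.
    have [w1 w1E] := edge_point_exists u1; have [w2 w2E] := edge_point_exists uN1.
    exists (w1, w2) => _ x /=; rewrite w1E w2E cd_dotNr; ring.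
  have [w {}wE] := choice wE.
  (* Pairs of vertices detect unequal diagonal entries, the other pairs a nonzero [(i0, i1)] entry.
     If neither occurs, the vanishing minor makes all diagonal entries zero, against trace [1]. *)
  exists ([seq (v i0, v j) | j <- enum 'I_n.+1] ++ [seq w b | b <- cd_basis R k]) => x.
  have [/existsP[j xj]|/existsPn xj] :=
      boolP [exists j, diag_entry x i0 != diag_entry x j].
    exists (v i0, v j).
      by rewrite mem_cat map_f ?mem_enum.
    rewrite !projective_cos /= (herm_inner_vertex _ (vE i0)).
    rewrite (herm_inner_vertex _ (vE j)).
    by apply: contraNneq xj => xj; apply/eqP; lra.
  have xjE j : diag_entry x j = diag_entry x i0.
    by have := xj j; rewrite negbK => /eqP.
  have [/hasP[b bk xb]|/hasPn xb] :=
      boolP (has (fun b => cd_dot (sval x i0 i1) b != 0) (cd_basis R k)).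
    exists (w b); first by rewrite mem_cat map_f ?orbT.
    have := wE b (cd_basis_unit bk) x.
    rewrite !projective_cos => wbE; apply: contraNneq xb => xb; apply/eqP.
    by move: wbE xb => /=; lra.
  have x01 : cd_dot (sval x i0 i1) (sval x i0 i1) = 0.
    rewrite cd_dot_basis big_seq big1 // => b /xb; rewrite negbK => /eqP ->.
    by rewrite mul0r.
  have := diag_entry_sum x; rewrite big1 => [/esym/eqP|j _]; first by rewrite oner_eq0.
  move: x01; rewrite projection_minor ?projective_is_projection // => /eqP.
  by rewrite -/(diag_entry x i0) -/(diag_entry x i1) !xjE mulf_eq0 orbb => /eqP.
- exists (v i0) => x.
  have [g ig [gx _ _]] := normal_form octonion_plane x x i01.
  exists g; first exact: projective_isometry_theta.
  apply: projective_inj; apply: herm_inner_eq1; rewrite ?projective_is_projection //.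
  by rewrite (herm_inner_vertex _ (vE i0)).
Qed.

End ProjectiveGeometry.

(** * Chordal and symmetric difference metrics on all rank one spaces *)

Theorem theorem1p1 (R : realType) (Q : rank_one_space)
    (mu : probability (borel R Q) R) (mu_invariant : isometry_invariant mu) :
  exists gamma : R,
    [/\ gamma = mean mu (@tau R Q) / mean mu (theta_delta mu (@xi_natural R)),
        gamma = diam (@tau R Q) / diam (theta_delta mu (@xi_natural R))
      & forall x1 x2 : carrier R Q,
          tau x1 x2 = gamma * theta_delta mu (@xi_natural R) x1 x2].
Proof.
apply: (rank_one_chordal _ mu_invariant).
case: Q {mu mu_invariant} => [d d1|F n n2 octonion_plane].
  exact: sphere_geometry.
exact: projective_geometry.
Qed.
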